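(* Let $f:\mathbb{C}\to\mathbb{C}$ be a transcendental entire function with an omitted value. Then $f$ has infinite topological entropy, i.e. $h_{\operatorname{top}}(f)=\infty$.
   Context: A transcendental entire function is a holomorphic function $f:\mathbb{C}\to\mathbb{C}$ that is not a polynomial. A value $\beta\in\mathbb{C}$ is an omitted value of $f$ if $f(z)\neq\beta$ for all $z\in\mathbb{C}$. Definition of topological entropy. Let $f:Y\to Y$ be a self-map of a metric space $(Y,d)$. Let $X$ be a compact subset of $Y$, let $n\in\mathbb{N}$ ($n\ge 1$) and $\delta>0$. A set $E\subset X$ is called $(n,\delta)$-separated if: (i) for any $z\in E$, its orbit satisfies $\{z,f(z),\dots,f^{n-1}(z)\}\subset X$ (where $f^k$ denotes the $k$-th iterate of $f$); (ii) for any $z\neq w$ in $E$ there exists $0\le k\leq n-1$ such that $d(f^k(z),f^k(w))>\delta$. Let $K(n,\delta)$ be the maximal cardinality of an $(n,\delta)$-separated set. The topological entropy of $f$ on $X$ is $$h_{\operatorname{top}}(X,f):=\sup_{\delta>0}\left\{\limsup_{n\to\infty}\frac{1}{n}\log K(n,\delta)\right\},$$ and the topological entropy $h_{\operatorname{top}}(f)$ of $f$ on $Y$ is the supremum of $h_{\operatorname{top}}(X,f)$ over all compact subsets $X\subset Y$. Here $Y=\mathbb{C}$, and $d$ is the Euclidean metric or the spherical metric; since these are comparable on compact subsets of $\mathbb{C}$, both choices give the same value of $h_{\operatorname{top}}(f)$. *)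

(* Defs.v *)
(* Stdlib reals, with Coquelicot for complex numbers, complex derivatives and
   the extended reals Rbar. *)
From Stdlib Require Import Reals List.
From Coquelicot Require Import Coquelicot.

Open Scope R_scope.

Definition open_subset (M : Metric_Space) (U : Base M -> Prop) : Prop :=
  forall x, U x ->
  exists r, 0 < r /\ forall y, dist M x y < r -> U y.

Definition compact_subset (M : Metric_Space) (X : Base M -> Prop) : Prop :=
  forall (I : Type) (U : I -> Base M -> Prop),
  (forall i, open_subset M (U i)) ->
  (forall x, X x -> exists i, U i x) ->
  exists l : list I, forall x, X x -> exists i, In i l /\ U i x.

Definition separated (M : Metric_Space) (f : Base M -> Base M)
    (X : Base M -> Prop) (n : nat) (delta : R) (E : Base M -> Prop) : Prop :=
  (forall z, E z -> X z) /\
  (forall z, E z -> forall k, (k < n)%nat -> X (Nat.iter k f z)) /\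
  (forall z w, E z -> E w -> z <> w ->
    exists k, (k < n)%nat /\ dist M (Nat.iter k f z) (Nat.iter k f w) > delta).

(* The finite (n, delta)-separated sets are enumerated by duplicate-free lists.
   Subsets of separated sets are separated, so the supremum of the finite
   cardinalities is the maximal cardinality, and is p_infty exactly when
   separated sets can be arbitrarily large. *)
Definition max_separated (M : Metric_Space) (f : Base M -> Base M)
    (X : Base M -> Prop) (n : nat) (delta : R) : Rbar :=
  Lub_Rbar (fun c => exists l : list (Base M),
    NoDup l /\ separated M f X n delta (fun z => In z l) /\
    c = INR (length l)).

(* log 0 = -oo (Stdlib's ln is 0 outside the positive reals). *)
Definition Rbar_log (x : Rbar) : Rbar :=
  match x with
  | Finite r => if Rlt_dec 0 r then Finite (ln r) else m_infty
  | p_infty => p_infty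
  | m_infty => m_infty
  end.

(* Coquelicot's LimSup_seq only takes real sequences, for which it agrees with
   this formula by LimSup_InfSup_seq. *)
Definition Rbar_LimSup_seq (u : nat -> Rbar) : Rbar :=
  Inf_seq (fun m => Sup_seq (fun n => u (n + m)%nat)).

Definition entropy_on (M : Metric_Space) (X : Base M -> Prop)
    (f : Base M -> Base M) : Rbar :=
  Rbar_lub (fun h => exists delta, 0 < delta /\
    h = Rbar_LimSup_seq (fun n =>
          Rbar_mult (Finite (/ INR n))
                    (Rbar_log (max_separated M f X n delta)))).

Definition topological_entropy (M : Metric_Space) (f : Base M -> Base M)
    : Rbar :=
  Rbar_lub (fun h => exists X, compact_subset M X /\ h = entropy_on M X f).

Definition C_dist (z w : C) : R := Cmod (Cminus z w).

Lemma C_dist_pos (z w : C) : C_dist z w >= 0.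
Proof. apply Rle_ge, Cmod_ge_0. Qed.

Lemma C_dist_sym (z w : C) : C_dist z w = C_dist w z.
Proof.
unfold C_dist. rewrite <- Cmod_opp. f_equal. ring.
Qed.

Lemma C_dist_refl (z w : C) : C_dist z w = 0 <-> z = w.
Proof.
unfold C_dist; split.
- intros H. apply Cmod_eq_0 in H.
  replace z with (Cplus (Cminus z w) w) by ring. rewrite H. ring.
- intros ->. replace (Cminus w w) with (RtoC 0) by ring. apply Cmod_0.
Qed.

Lemma C_dist_tri (z w v : C) : C_dist z w <= C_dist z v + C_dist v w.
Proof.
unfold C_dist.
replace (Cminus z w) with (Cplus (Cminus z v) (Cminus v w)) by ring.
apply Cmod_triangle.
Qed.

Definition C_Metric_Space : Metric_Space :=
  Build_Metric_Space C C_dist C_dist_pos C_dist_sym C_dist_refl C_dist_tri.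

(* Complex differentiability: the scalar field is C_AbsRing, not R_AbsRing. *)
Definition entire (f : C -> C) : Prop :=
  forall z : C, @ex_derive C_AbsRing C_NormedModule f z.

Definition polynomial (f : C -> C) : Prop :=
  exists (N : nat) (a : nat -> C),
  forall z : C, f z = sum_n (fun k => Cmult (a k) (Cpow z k)) N.

Definition transcendental_entire (f : C -> C) : Prop :=
  entire f /\ ~ polynomial f.

Definition omitted_value (f : C -> C) (beta : C) : Prop :=
  forall z : C, f z <> beta.

(* Main.v *)
(* After translating, [f] omits 0, so [f = exp g] on any disk, and
   [F w = g (exp w)] satisfies [exp (F w) = f (exp w)]. On some large circle [|f|]
   takes both values below the radius [r] and values far above it, hence on a vertical
   segment of length [2 PI] at [Re w = ln r] the function [Re F] rises from below
   [ln r] to far above it. A Bloch-type rescaling, weighted by [sqrt (u^2 + 1)]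
   with [u] a multiple of [Re F - ln r], produces a rescaled copy of [F] of
   bounded geometry whose real part vanishes somewhere; by Harnack's inequality
   it covers a disk of absolute size around a value on the imaginary axis. Undoing
   the scaling, [F] covers an arbitrarily large disk centred on [Re w = ln r],
   which contains arbitrarily many translates by [2 PI i] of a fundamental domain
   of [exp] over an annulus. So [f] has a horseshoe with arbitrarily many
   branches. *)
Require Import Defs.
From Stdlib Require Import Reals ZArith Lra Lia List FinFun Classical ClassicalEpsilon.
From Coquelicot Require Import Coquelicot.

(** A disk covered by [F] is useful only if its centre has real part near [ln r], and an ordinary
    Bloch theorem gives no control over the centre. The weight [sqrt (u^2 + 1)] supplies it, for two
    reasons. It is the reciprocal of the derivative of [arcsinh], so a bound on the weighted
    derivative is a Lipschitz bound for [arcsinh u]: a large rise of [u] forces a large weighted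
    derivative, and after rescaling [u] stays bounded. It also exceeds [|u|], so the normalisation
    [|G' 0| = sqrt (u^2 + 1)] contradicts Schwarz-Pick for a half-plane unless [u] vanishes nearby.
    Preimages are found in a disk of absolute radius 16, independent of the number of branches. Its
    image under [exp] is the set that covers itself, so the required covering radius is known before
    the rise [L] and the circle are chosen. The large value of [|f|] on the circle comes from
    transcendence, since linear growth would make [f] affine; the small value comes from the maximum
    principle for [1 / f]. *)

(** * Moduli, real and imaginary parts *)

Lemma Cmod_minus_sym (z w : C) : Cmod (z - w) = Cmod (w - z).
Proof. rewrite <- Cmod_opp; f_equal; ring. Qed.

Lemma Cmod_minus_triangle (x y z : C) :
  Cmod (x - z) <= Cmod (x - y) + Cmod (y - z).
Proof. replace (x - z)%C with ((x - y) + (y - z))%C by ring; apply Cmod_triangle. Qed.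

Lemma Cmod_le_add (z w : C) : Cmod z <= Cmod w + Cmod (z - w).
Proof. replace z with (w + (z - w))%C at 1 by ring; apply Cmod_triangle. Qed.

Lemma Cmod_le_abs (x y : R) : Cmod (x, y) <= Rabs x + Rabs y.
Proof.
  replace (x, y) with ((RtoC x) + Ci * (RtoC y))%C.
  - eapply Rle_trans; [apply Cmod_triangle|].
    rewrite Cmod_mult, Cmod_Ci, !Cmod_R; lra.
  - apply injective_projections; simpl; ring.
Qed.

Lemma Rabs_fst_Cmod (z : C) : Rabs (fst z) <= Cmod z.
Proof. eapply Rle_trans; [apply Rmax_l|apply Rmax_Cmod]. Qed.

Lemma Rabs_snd_Cmod (z : C) : Rabs (snd z) <= Cmod z.
Proof. eapply Rle_trans; [apply Rmax_r|apply Rmax_Cmod]. Qed.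

Lemma Cmod_sqr (z : C) : Cmod z ^ 2 = fst z ^ 2 + snd z ^ 2.
Proof. apply Cmod2_alt. Qed.

Lemma Cmod_minus_eq (z w : C) : Cmod (z - w) <= 0 -> z = w.
Proof.
  intros H; replace z with ((z - w) + w)%C by ring.
  rewrite (Cmod_eq_0 (z - w)%C); [ring|].
  apply Rle_antisym; [exact H|apply Cmod_ge_0].
Qed.

Lemma real_multiple (z : C) (x : R) : (RtoC x * z)%C = (x * fst z, x * snd z).
Proof. apply injective_projections; simpl; ring. Qed.

Lemma Cmod_RtoC_mult (x : R) (z : C) : 0 <= x -> Cmod (RtoC x * z)%C = x * Cmod z.
Proof. intros H; rewrite Cmod_mult, Cmod_R, Rabs_pos_eq; [reflexivity|exact H]. Qed.

(** Turns statements about real parts, which is what real integrals and the real mean value theorem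
    give, into statements about moduli. *)
Lemma rotate_to_real (z : C) : exists c, Cmod c = 1 /\ (c * z)%C = RtoC (Cmod z).
Proof.
  destruct (classic (z = RtoC 0)) as [->|Hz].
  - exists (RtoC 1); rewrite Cmod_1, Cmod_0; split; [reflexivity|ring].
  - assert (Hm : 0 < Cmod z) by (apply Cmod_gt_0, Hz).
    assert (HR0 : RtoC (Cmod z) <> RtoC 0) by (intros K; apply RtoC_inj in K; lra).
    exists (Cconj z / RtoC (Cmod z))%C; split.
    + rewrite Cmod_div by exact HR0.
      rewrite Cmod_conj, Cmod_R, Rabs_pos_eq by lra; field; lra.
    + replace (Cconj z / Cmod z * z)%C with ((z * Cconj z) / Cmod z)%C
        by (field; exact HR0).
      rewrite <- Cmod2_conj, RtoC_pow; simpl; field; exact HR0.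
Qed.

(** * Complex differentiability *)

Definition C_cont (f : C -> C) (z : C) : Prop :=
  forall eps, 0 < eps -> exists d, 0 < d /\
  forall w, Cmod (w - z) < d -> Cmod (f w - f z) < eps.

(* Coquelicot's product and chain rules are stated for
   [AbsRing_NormedModule C_AbsRing], whose uniform structure is not that of
   [C_NormedModule]; hence this epsilon-delta form. *)
Definition C_diff (f : C -> C) (z l : C) : Prop :=
  forall eps, 0 < eps -> exists d, 0 < d /\
  forall w, Cmod (w - z) < d ->
    Cmod (f w - f z - l * (w - z)) <= eps * Cmod (w - z).

Lemma is_derive_C_diff (f : C -> C) (z l : C) :
  @is_derive C_AbsRing C_NormedModule f z l -> C_diff f z l.
Proof.
  intros [_ H] eps He.
  specialize (H z (fun P HP => HP) (mkposreal eps He)).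
  destruct H as [d Hd].
  exists d; split; [apply cond_pos|].
  intros w Hw.
  specialize (Hd w Hw).
  replace (f w - f z - l * (w - z))%C
    with (minus (minus (f w) (f z)) (scal (minus w z) l)).
  { refine (Rle_trans _ _ _ Hd _); apply Req_le; reflexivity. }
  change (((f w - f z) - (w - z) * l)%C = (f w - f z - l * (w - z))%C); ring.
Qed.

Lemma C_diff_cont (f : C -> C) (z l : C) : C_diff f z l -> C_cont f z.
Proof.
  intros H eps He.
  destruct (H 1 Rlt_0_1) as [d [Hd H1]].
  pose proof (Cmod_ge_0 l) as Hl.
  exists (Rmin d (eps / (2 + Cmod l))); split.
  - apply Rmin_pos; [lra|apply Rdiv_lt_0_compat; lra].
  - intros w Hw.
    assert (Hw1 := Rlt_le_trans _ _ _ Hw (Rmin_l _ _)).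
    assert (Hw2 := Rlt_le_trans _ _ _ Hw (Rmin_r _ _)).
    specialize (H1 w Hw1).
    pose proof (Cmod_le_add (f w - f z) (l * (w - z))) as H2.
    rewrite Cmod_mult in H2.
    apply (Rmult_lt_compat_r (2 + Cmod l)) in Hw2; [|lra].
    replace (eps / (2 + Cmod l) * (2 + Cmod l)) with eps in Hw2 by (field; lra).
    pose proof (Cmod_ge_0 (w - z)).
    nra.
Qed.

Lemma C_cont_const (c z : C) : C_cont (fun _ => c) z.
Proof.
  intros eps He; exists 1; split; [lra|]; intros w _.
  replace (c - c)%C with (RtoC 0) by ring; rewrite Cmod_0; exact He.
Qed.

Lemma C_cont_comp (f g : C -> C) (z : C) :
  C_cont g z -> C_cont f (g z) -> C_cont (fun w => f (g w)) z.
Proof.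
  intros Hg Hf eps He.
  destruct (Hf eps He) as [d [Hd H1]].
  destruct (Hg d Hd) as [d' [Hd' H2]].
  exists d'; split; auto.
Qed.

Lemma C_cont_plus (f g : C -> C) (z : C) :
  C_cont f z -> C_cont g z -> C_cont (fun w => f w + g w)%C z.
Proof.
  intros Hf Hg eps He.
  destruct (Hf (eps / 2)) as [d1 [Hd1 H1]]; [lra|].
  destruct (Hg (eps / 2)) as [d2 [Hd2 H2]]; [lra|].
  exists (Rmin d1 d2); split; [apply Rmin_pos; lra|].
  intros w Hw.
  specialize (H1 w (Rlt_le_trans _ _ _ Hw (Rmin_l _ _))).
  specialize (H2 w (Rlt_le_trans _ _ _ Hw (Rmin_r _ _))).
  replace (f w + g w - (f z + g z))%C with ((f w - f z) + (g w - g z))%C by ring.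
  eapply Rle_lt_trans; [apply Cmod_triangle|lra].
Qed.

Lemma C_diff_ext_loc (f g : C -> C) (z l : C) (d : R) : 0 < d ->
  (forall w, Cmod (w - z) < d -> f w = g w) -> C_diff f z l -> C_diff g z l.
Proof.
  intros Hd He Hf eps Heps.
  destruct (Hf eps Heps) as [d' [Hd' H]].
  exists (Rmin d d'); split; [apply Rmin_pos; lra|].
  intros w Hw.
  rewrite <- !He.
  - apply H; eapply Rlt_le_trans; [exact Hw|apply Rmin_r].
  - replace (z - z)%C with (RtoC 0) by ring; rewrite Cmod_0; exact Hd.
  - eapply Rlt_le_trans; [exact Hw|apply Rmin_l].
Qed.

Lemma C_diff_eq (f : C -> C) (z l l' : C) : C_diff f z l -> l = l' -> C_diff f z l'.
Proof. intros H <-; exact H. Qed.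

Lemma C_diff_const (c z : C) : C_diff (fun _ => c) z 0.
Proof.
  intros eps He; exists 1; split; [lra|]; intros w _.
  replace (c - c - 0 * (w - z))%C with (RtoC 0) by ring.
  rewrite Cmod_0; apply Rmult_le_pos; [lra|apply Cmod_ge_0].
Qed.

Lemma C_diff_id (z : C) : C_diff (fun w => w) z 1.
Proof.
  intros eps He; exists 1; split; [lra|]; intros w _.
  replace (w - z - 1 * (w - z))%C with (RtoC 0) by ring.
  rewrite Cmod_0; apply Rmult_le_pos; [lra|apply Cmod_ge_0].
Qed.

Lemma C_diff_plus (f g : C -> C) (z l m : C) :
  C_diff f z l -> C_diff g z m -> C_diff (fun w => f w + g w)%C z (l + m).
Proof.
  intros Hf Hg eps He.
  destruct (Hf (eps / 2)) as [d1 [Hd1 H1]]; [lra|].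
  destruct (Hg (eps / 2)) as [d2 [Hd2 H2]]; [lra|].
  exists (Rmin d1 d2); split; [apply Rmin_pos; lra|].
  intros w Hw.
  specialize (H1 w (Rlt_le_trans _ _ _ Hw (Rmin_l _ _))).
  specialize (H2 w (Rlt_le_trans _ _ _ Hw (Rmin_r _ _))).
  replace (f w + g w - (f z + g z) - (l + m) * (w - z))%C
    with ((f w - f z - l * (w - z)) + (g w - g z - m * (w - z)))%C by ring.
  eapply Rle_trans; [apply Cmod_triangle|lra].
Qed.

Lemma C_diff_comp (f g : C -> C) (z l m : C) :
  C_diff g z m -> C_diff f (g z) l -> C_diff (fun w => f (g w)) z (l * m).
Proof.
  intros Hg Hf eps He.
  pose proof (Cmod_ge_0 l) as Hl; pose proof (Cmod_ge_0 m) as Hm.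
  set (e1 := eps / (2 * (Cmod m + 1))).
  assert (He1 : 0 < e1) by (apply Rdiv_lt_0_compat; lra).
  (* The bound [e2 <= 1] gives [|g w - g z| <= (|m| + 1) |w - z|]; the other bound controls the term
     multiplied by [l]. *)
  set (e2 := Rmin 1 (eps / (2 * (Cmod l + 1)))).
  assert (He2 : 0 < e2)
    by (apply Rmin_pos; [lra|apply Rdiv_lt_0_compat; lra]).
  destruct (Hf e1 He1) as [d1 [Hd1 H1]].
  destruct (Hg e2 He2) as [d2 [Hd2 H2]].
  destruct (C_diff_cont _ _ _ Hg d1 Hd1) as [d3 [Hd3 H3]].
  exists (Rmin d2 d3); split; [apply Rmin_pos; lra|].
  intros w Hw.
  specialize (H2 w (Rlt_le_trans _ _ _ Hw (Rmin_l _ _))).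
  specialize (H3 w (Rlt_le_trans _ _ _ Hw (Rmin_r _ _))).
  specialize (H1 (g w) H3).
  replace (f (g w) - f (g z) - l * m * (w - z))%C
    with ((f (g w) - f (g z) - l * (g w - g z))
          + l * (g w - g z - m * (w - z)))%C by ring.
  eapply Rle_trans; [apply Cmod_triangle|].
  rewrite Cmod_mult.
  pose proof (Cmod_le_add (g w - g z) (m * (w - z))) as H4.
  rewrite Cmod_mult in H4.
  pose proof (Cmod_ge_0 (w - z)) as Hwz.
  assert (He2a : e2 <= 1) by apply Rmin_l.
  assert (He2b : Cmod l * e2 <= eps / 2).
  { apply Rle_trans with (Cmod l * (eps / (2 * (Cmod l + 1)))).
    - apply Rmult_le_compat_l; [lra|apply Rmin_r].
    - replace (eps / 2) with ((Cmod l + 1) * (eps / (2 * (Cmod l + 1))))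
        by (field; lra).
      apply Rmult_le_compat_r; [|lra].
      apply Rlt_le, Rdiv_lt_0_compat; lra. }
  assert (H5 : Cmod (g w - g z) <= (Cmod m + 1) * Cmod (w - z)) by nra.
  assert (H6 : e1 * Cmod (g w - g z) <= eps / 2 * Cmod (w - z)).
  { apply Rle_trans with (e1 * ((Cmod m + 1) * Cmod (w - z))).
    - apply Rmult_le_compat_l; lra.
    - apply Req_le; unfold e1; field; lra. }
  assert (H7 : Cmod l * Cmod (g w - g z - m * (w - z)) <= eps / 2 * Cmod (w - z)).
  { apply Rle_trans with (Cmod l * (e2 * Cmod (w - z))).
    - apply Rmult_le_compat_l; lra.
    - rewrite <- Rmult_assoc; apply Rmult_le_compat_r; lra. }
  lra.
Qed.

Lemma C_diff_mult_const (c z l : C) (f : C -> C) :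
  C_diff f z l -> C_diff (fun w => c * f w)%C z (c * l).
Proof.
  intros Hf.
  apply (C_diff_comp (fun w => c * w)%C f z c l Hf).
  intros eps He; exists 1; split; [lra|]; intros w _.
  match goal with |- Cmod ?x <= _ => replace x with (RtoC 0) by ring end.
  rewrite Cmod_0; apply Rmult_le_pos; [lra|apply Cmod_ge_0].
Qed.

Lemma C_diff_minus (f g : C -> C) (z l m : C) :
  C_diff f z l -> C_diff g z m -> C_diff (fun w => f w - g w)%C z (l - m).
Proof.
  intros Hf Hg.
  apply (C_diff_ext_loc (fun w => f w + (- (1)) * g w)%C _ z _ 1 Rlt_0_1).
  { intros; ring. }
  eapply C_diff_eq.
  - apply C_diff_plus; [exact Hf|apply C_diff_mult_const, Hg].
  - ring.
Qed.

Lemma C_diff_sqr (z : C) : C_diff (fun w => w * w)%C z (2 * z).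
Proof.
  intros eps He; exists eps; split; [exact He|]; intros w Hw.
  replace (w * w - z * z - 2 * z * (w - z))%C with ((w - z) * (w - z))%C by ring.
  rewrite Cmod_mult; apply Rmult_le_compat_r; [apply Cmod_ge_0|lra].
Qed.

(* Polarisation reduces products to squares. *)
Lemma C_diff_mult (f g : C -> C) (z l m : C) :
  C_diff f z l -> C_diff g z m ->
  C_diff (fun w => f w * g w)%C z (l * g z + f z * m).
Proof.
  intros Hf Hg.
  apply (C_diff_ext_loc
    (fun w => (1 / 4) * ((f w + g w) * (f w + g w) - (f w - g w) * (f w - g w)))%C
    _ z _ 1 Rlt_0_1).
  { intros; field. }
  eapply C_diff_eq.
  - apply C_diff_mult_const, C_diff_minus.
    + apply (C_diff_comp (fun w => w * w)%C (fun w => f w + g w)%C);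
        [apply C_diff_plus; eassumption|apply C_diff_sqr].
    + apply (C_diff_comp (fun w => w * w)%C (fun w => f w - g w)%C);
        [apply C_diff_minus; eassumption|apply C_diff_sqr].
  - field.
Qed.

Lemma C_diff_Cinv (z : C) : z <> RtoC 0 -> C_diff Cinv z (- / (z * z)).
Proof.
  intros Hz eps He.
  assert (Hm : 0 < Cmod z) by (apply Cmod_gt_0; exact Hz).
  set (d := Rmin (Cmod z / 2) (eps * Cmod z ^ 3 / 2)).
  assert (Hd : 0 < d).
  { apply Rmin_pos; [lra|].
    assert (0 < Cmod z ^ 3) by (apply pow_lt; lra). nra. }
  exists d; split; [exact Hd|]; intros w Hw.
  assert (Hw1 : Cmod (w - z) < Cmod z / 2)
    by (eapply Rlt_le_trans; [exact Hw|apply Rmin_l]).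
  assert (Hw2 : Cmod (w - z) < eps * Cmod z ^ 3 / 2)
    by (eapply Rlt_le_trans; [exact Hw|apply Rmin_r]).
  assert (Hwm : Cmod z / 2 <= Cmod w).
  { pose proof (Cmod_le_add z w) as Ht; rewrite (Cmod_minus_sym z w) in Ht; lra. }
  assert (Hw0 : w <> RtoC 0) by (apply Cmod_gt_0; lra).
  replace (/ w - / z - - / (z * z) * (w - z))%C
    with ((w - z) * (w - z) / (w * (z * z)))%C by (field; auto).
  rewrite Cmod_div by (repeat apply Cmult_neq_0; assumption).
  rewrite !Cmod_mult.
  pose proof (Cmod_ge_0 (w - z)) as H0.
  apply Rmult_le_reg_r with (Cmod w * (Cmod z * Cmod z)).
  { repeat apply Rmult_lt_0_compat; lra. }
  replace (Cmod (w - z) * Cmod (w - z) / (Cmod w * (Cmod z * Cmod z)) *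
    (Cmod w * (Cmod z * Cmod z))) with (Cmod (w - z) * Cmod (w - z))
    by (field; lra).
  replace (eps * Cmod (w - z) * (Cmod w * (Cmod z * Cmod z)))
    with (Cmod (w - z) * (eps * (Cmod w * (Cmod z * Cmod z)))) by ring.
  apply Rmult_le_compat_l; [exact H0|].
  apply Rle_trans with (eps * Cmod z ^ 3 / 2); [lra|].
  replace (eps * Cmod z ^ 3 / 2)
    with (eps * ((Cmod z / 2) * (Cmod z * Cmod z))) by field.
  apply Rmult_le_compat_l; [lra|].
  apply Rmult_le_compat_r; [nra|lra].
Qed.

Lemma C_diff_inv (f : C -> C) (z l : C) : f z <> RtoC 0 -> C_diff f z l ->
  C_diff (fun w => / f w)%C z (- l / (f z * f z)).
Proof.
  intros Hz Hf; eapply C_diff_eq.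
  - apply (C_diff_comp Cinv f z _ _ Hf (C_diff_Cinv _ Hz)).
  - field; exact Hz.
Qed.

Lemma C_diff_affine (a m z : C) : C_diff (fun w => a + m * w)%C z m.
Proof.
  eapply C_diff_eq.
  - apply C_diff_plus; [apply C_diff_const|apply C_diff_mult_const, C_diff_id].
  - ring.
Qed.

(** Gives access to the real mean value and intermediate value theorems along segments. *)
Lemma Re_path_derivable (f : C -> C) (a b l : C) (t : R) :
  C_diff f (a + RtoC t * b)%C l ->
  derivable_pt_lim (fun s => fst (f (a + RtoC s * b)%C)) t (fst (l * b)%C).
Proof.
  intros H eps He.
  pose proof (Cmod_ge_0 b) as Hb.
  destruct (H (eps / (2 * (Cmod b + 1)))) as [d [Hd H1]].
  { apply Rdiv_lt_0_compat; lra. }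
  assert (Hd' : 0 < d / (Cmod b + 1)) by (apply Rdiv_lt_0_compat; lra).
  exists (mkposreal _ Hd'); intros h Hh0 Hh; simpl in Hh.
  assert (E : (a + RtoC (t + h) * b - (a + RtoC t * b) = RtoC h * b)%C)
    by (rewrite RtoC_plus; ring).
  specialize (H1 (a + RtoC (t + h) * b)%C).
  rewrite E, Cmod_mult, Cmod_R in H1.
  assert (Hh1 : Rabs h * (Cmod b + 1) < d).
  { apply (Rmult_lt_compat_r (Cmod b + 1)) in Hh; [|lra].
    replace (d / (Cmod b + 1) * (Cmod b + 1)) with d in Hh by (field; lra).
    exact Hh. }
  assert (Hpos : 0 < Rabs h) by (apply Rabs_pos_lt; exact Hh0).
  assert (Hlt : Rabs h * Cmod b < d) by nra.
  specialize (H1 Hlt).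
  set (E1 := (f (a + RtoC (t + h) * b) - f (a + RtoC t * b) - l * (RtoC h * b))%C) in *.
  assert (E2 : (fst (f (a + RtoC (t + h) * b)%C) - fst (f (a + RtoC t * b)%C)) / h
            - fst (l * b)%C = fst E1 / h).
  { unfold E1; simpl; field; exact Hh0. }
  rewrite E2; unfold Rdiv; rewrite Rabs_mult, Rabs_inv.
  apply Rle_lt_trans with (Cmod E1 * / Rabs h).
  { apply Rmult_le_compat_r; [apply Rlt_le, Rinv_0_lt_compat; lra|apply Rabs_fst_Cmod]. }
  apply Rmult_lt_reg_r with (Rabs h); [exact Hpos|].
  replace (Cmod E1 * / Rabs h * Rabs h) with (Cmod E1) by (field; lra).
  eapply Rle_lt_trans; [exact H1|].
  replace (eps / (2 * (Cmod b + 1)) * (Rabs h * Cmod b))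
    with ((eps * Rabs h) * (Cmod b / (2 * (Cmod b + 1)))) by (field; lra).
  rewrite <- (Rmult_1_r (eps * Rabs h)) at 2.
  apply Rmult_lt_compat_l; [nra|].
  apply Rmult_lt_reg_r with (2 * (Cmod b + 1)); [lra|].
  replace (Cmod b / (2 * (Cmod b + 1)) * (2 * (Cmod b + 1))) with (Cmod b)
    by (field; lra).
  lra.
Qed.

(** * Induction on boxes *)

Lemma nested_intervals (a b : nat -> R) :
  (forall n, a n <= a (S n)) -> (forall n, b (S n) <= b n) ->
  (forall n, a n <= b n) -> exists x, forall n, a n <= x <= b n.
Proof.
  intros Ha Hb Hab.
  assert (Ma : forall n k, a n <= a (n + k)%nat).
  { intros n k; induction k as [|k IH]; [rewrite Nat.add_0_r; lra|].
    rewrite Nat.add_succ_r; specialize (Ha (n + k)%nat); lra. }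
  assert (Mb : forall n k, b (n + k)%nat <= b n).
  { intros n k; induction k as [|k IH]; [rewrite Nat.add_0_r; lra|].
    rewrite Nat.add_succ_r; specialize (Hb (n + k)%nat); lra. }
  assert (Mab : forall n k, a n <= b k).
  { intros n k; specialize (Ma n k); specialize (Mb k n).
    rewrite (Nat.add_comm k n) in Mb; specialize (Hab (n + k)%nat); lra. }
  destruct (completeness (fun x => exists n, x = a n)) as [x [Hx1 Hx2]].
  - exists (b O); intros y [n ->]; apply Mab.
  - exists (a O), O; reflexivity.
  - exists x; intros n; split.
    + apply Hx1; exists n; reflexivity.
    + apply Hx2; intros y [k ->]; apply Mab.
Qed.

(** Bisection: if [P] fails on a box, it fails on one of its quarters, and the nested failing boxes
    shrink to a point where the local hypothesis gives a contradiction. It serves both Goursat's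
    theorem and the compactness of disks. *)
Lemma box_induction (P : R -> R -> R -> R -> Prop) (a0 b0 c0 d0 : R) :
  (forall a b c d, a <= b -> c <= d ->
    let m := (a + b) / 2 in let n := (c + d) / 2 in
    P a m c n -> P m b c n -> P a m n d -> P m b n d -> P a b c d) ->
  (forall x y, a0 <= x <= b0 -> c0 <= y <= d0 ->
    exists e, 0 < e /\ forall a b c d, a <= x <= b -> c <= y <= d ->
      b - a < e -> d - c < e -> P a b c d) ->
  a0 <= b0 -> c0 <= d0 -> P a0 b0 c0 d0.
Proof.
  intros Hglue Hloc Hab Hcd.
  destruct (classic (P a0 b0 c0 d0)) as [H|H]; [exact H|exfalso].
  set (pick := fun s : R * R * R * R =>
    let '(a, b, c, d) := s in
    let m := (a + b) / 2 in let n := (c + d) / 2 in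
    if excluded_middle_informative (P a m c n) then
      if excluded_middle_informative (P m b c n) then
        if excluded_middle_informative (P a m n d) then (m, b, n, d)
        else (a, m, n, d)
      else (m, b, c, n)
    else (a, m, c, n)).
  set (q := fun n => Nat.iter n pick (a0, b0, c0, d0)).
  set (a := fun n => fst (fst (fst (q n)))).
  set (b := fun n => snd (fst (fst (q n)))).
  set (c := fun n => snd (fst (q n))).
  set (d := fun n => snd (q n)).
  assert (Hq : forall n, q n = (a n, b n, c n, d n)).
  { intros n; unfold a, b, c, d; destruct (q n) as [[[? ?] ?] ?]; reflexivity. }
  assert (Hstep : forall n, q (S n) = pick (a n, b n, c n, d n)).
  { intros n; rewrite <- Hq; reflexivity. }
  assert (Hinv : forall n, a n <= b n /\ c n <= d n /\
    ~ P (a n) (b n) (c n) (d n) /\ b n - a n = (b0 - a0) / 2 ^ n /\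
    d n - c n = (d0 - c0) / 2 ^ n).
  { induction n as [|n (I1 & I2 & I3 & I4 & I5)].
    - unfold a, b, c, d; simpl; repeat split; auto; field.
    - assert (Hs := Hstep n); rewrite (Hq (S n)) in Hs; simpl in Hs.
      assert (E : forall x, x / 2 ^ S n = x / 2 ^ n / 2)
        by (intros x; simpl; field; apply pow_nonzero; lra).
      rewrite !E, <- I4, <- I5.
      repeat destruct excluded_middle_informative in Hs;
        injection Hs as -> -> -> ->; repeat split; try lra; try assumption.
      intros HP; apply I3; apply Hglue; assumption. }
  assert (Hmono : forall n, a n <= a (S n) /\ b (S n) <= b n /\
     c n <= c (S n) /\ d (S n) <= d n).
  { intros n; destruct (Hinv n) as (I1 & I2 & _).
    assert (Hs := Hstep n); rewrite (Hq (S n)) in Hs; simpl in Hs.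
    repeat destruct excluded_middle_informative in Hs;
      injection Hs as -> -> -> ->; repeat split; lra. }
  destruct (nested_intervals a b) as [x Hx];
    [intros n; apply Hmono|intros n; apply Hmono|intros n; apply Hinv|].
  destruct (nested_intervals c d) as [y Hy];
    [intros n; apply Hmono|intros n; apply Hmono|intros n; apply Hinv|].
  destruct (Hloc x y (Hx O) (Hy O)) as [e [He HP]].
  assert (Hn : exists n, (b0 - a0) / 2 ^ n < e /\ (d0 - c0) / 2 ^ n < e).
  { destruct (pow_lt_1_zero (1 / 2) ltac:(rewrite Rabs_pos_eq; lra)
      (e / (1 + (b0 - a0) + (d0 - c0)))) as [n Hn].
    { apply Rdiv_lt_0_compat; lra. }
    exists n; specialize (Hn n (le_n n)).
    assert (Hp : (1 / 2) ^ n = / 2 ^ n)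
      by (unfold Rdiv; rewrite Rmult_1_l, pow_inv; reflexivity).
    assert (H2 : 0 < / 2 ^ n) by (apply Rinv_0_lt_compat, pow_lt; lra).
    rewrite Hp, Rabs_pos_eq in Hn by lra.
    apply (Rmult_lt_compat_r (1 + (b0 - a0) + (d0 - c0))) in Hn; [|lra].
    replace (e / (1 + (b0 - a0) + (d0 - c0)) * (1 + (b0 - a0) + (d0 - c0)))
      with e in Hn by (field; lra).
    unfold Rdiv; split; nra. }
  destruct Hn as [n [Hn1 Hn2]].
  destruct (Hinv n) as (I1 & I2 & I3 & I4 & I5).
  apply I3, HP; [apply Hx|apply Hy|lra|lra].
Qed.

(** * The complex exponential *)

Definition Cexp (z : C) : C := (exp (fst z) * cos (snd z), exp (fst z) * sin (snd z)).

Lemma Cexp_plus (z w : C) : Cexp (z + w) = (Cexp z * Cexp w)%C.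
Proof.
  unfold Cexp; apply injective_projections; simpl;
    rewrite exp_plus, ?cos_plus, ?sin_plus; ring.
Qed.

Lemma Cexp_0 : Cexp 0 = RtoC 1.
Proof.
  unfold Cexp; apply injective_projections; simpl;
    rewrite exp_0, ?cos_0, ?sin_0; ring.
Qed.

Lemma Cmod_Cexp (z : C) : Cmod (Cexp z) = exp (fst z).
Proof.
  unfold Cexp, Cmod; simpl.
  replace (_ + _) with (Rsqr (exp (fst z)) * (Rsqr (sin (snd z)) + Rsqr (cos (snd z))))
    by (unfold Rsqr; ring).
  rewrite sin2_cos2, Rmult_1_r, sqrt_Rsqr; [reflexivity|apply Rlt_le, exp_pos].
Qed.

Lemma Cexp_neq_0 (z : C) : Cexp z <> RtoC 0.
Proof. apply Cmod_gt_0; rewrite Cmod_Cexp; apply exp_pos. Qed.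

Lemma derivable_bound (f : R -> R) (l : R) :
  derivable_pt_lim f 0 l -> forall eps, 0 < eps -> exists d, 0 < d /\
  forall h, Rabs h < d -> Rabs (f h - f 0 - l * h) <= eps * Rabs h.
Proof.
  intros H eps He; destruct (H eps He) as [d Hd].
  exists d; split; [apply cond_pos|]; intros h Hh.
  destruct (Req_dec h 0) as [->|H0].
  - replace (f 0 - f 0 - l * 0) with 0 by ring; rewrite Rabs_R0; lra.
  - specialize (Hd h H0 Hh); rewrite Rplus_0_l in Hd.
    replace (f h - f 0 - l * h) with (((f h - f 0) / h - l) * h) by (field; exact H0).
    rewrite Rabs_mult; apply Rmult_le_compat_r; [apply Rabs_pos|lra].
Qed.

Lemma C_diff_Cexp_0 : C_diff Cexp 0 1.
Proof.
  intros eps He.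
  destruct (derivable_bound exp 1) with (eps := Rmin 1 (eps / 6)) as [d1 [Hd1 H1]].
  { pose proof (derivable_pt_lim_exp 0) as D; rewrite exp_0 in D; exact D. }
  { apply Rmin_pos; lra. }
  destruct (derivable_bound cos 0) with (eps := eps / 6) as [d2 [Hd2 H2]].
  { pose proof (derivable_pt_lim_cos 0) as D; rewrite sin_0, Ropp_0 in D; exact D. }
  { lra. }
  destruct (derivable_bound sin 1) with (eps := Rmin 1 (eps / 6)) as [d3 [Hd3 H3]].
  { pose proof (derivable_pt_lim_sin 0) as D; rewrite cos_0 in D; exact D. }
  { apply Rmin_pos; lra. }
  (* The product [(ex + x) * sin y] is of second order, at most [4 r^2]; the bound [r < eps / 12]
     turns this into two of the six shares [eps / 6 * r]. *)
  set (d := Rmin (Rmin d1 d2) (Rmin d3 (Rmin 1 (eps / 12)))).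
  exists d; split; [unfold d; repeat apply Rmin_pos; lra|].
  intros [x y] Hw.
  assert (E0 : ((x, y) - 0)%C = (x, y)) by (apply injective_projections; simpl; ring).
  rewrite E0 in *.
  pose proof (Rabs_fst_Cmod (x, y)) as Hx; pose proof (Rabs_snd_Cmod (x, y)) as Hy.
  simpl in Hx, Hy.
  set (r := Cmod (x, y)) in *.
  assert (Hr : r < d1 /\ r < d2 /\ r < d3 /\ r < 1 /\ r < eps / 12).
  { unfold d in Hw; revert Hw; unfold Rmin; repeat destruct Rle_dec; intros; lra. }
  destruct Hr as (Hr1 & Hr2 & Hr3 & Hr4 & Hr5).
  specialize (H1 x (Rle_lt_trans _ _ _ Hx Hr1)).
  specialize (H2 y (Rle_lt_trans _ _ _ Hy Hr2)).
  specialize (H3 y (Rle_lt_trans _ _ _ Hy Hr3)).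
  rewrite exp_0 in H1; rewrite cos_0 in H2; rewrite sin_0 in H3.
  rewrite Cexp_0.
  set (ex := exp x - 1 - 1 * x) in *.
  set (ec := cos y - 1 - 0 * y) in *.
  set (es := sin y - 0 - 1 * y) in *.
  assert (E : (Cexp (x, y) - 1 - 1 * (x, y))%C =
    (ex * cos y + (1 + x) * ec, (ex + x) * sin y + es)).
  { unfold Cexp, ex, ec, es; apply injective_projections; simpl; ring. }
  rewrite E; eapply Rle_trans; [apply Cmod_le_abs|].
  assert (Hc : Rabs (cos y) <= 1) by (apply Rabs_le; pose proof (COS_bound y); lra).
  assert (Hs1 : Rabs (sin y) <= 1) by (apply Rabs_le; pose proof (SIN_bound y); lra).
  assert (B1 : Rabs ex <= eps / 6 * r /\ Rabs ex <= r).
  { pose proof (Rmin_l 1 (eps / 6)); pose proof (Rmin_r 1 (eps / 6)).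
    pose proof (Rabs_pos x); split; nra. }
  assert (B2 : Rabs ec <= eps / 6 * r) by (pose proof (Rabs_pos y); nra).
  assert (B3 : Rabs es <= eps / 6 * r /\ Rabs es <= r).
  { pose proof (Rmin_l 1 (eps / 6)); pose proof (Rmin_r 1 (eps / 6)).
    pose proof (Rabs_pos y); split; nra. }
  assert (Hr0 : 0 <= r) by apply Cmod_ge_0.
  assert (T1 : Rabs (ex * cos y) <= eps / 6 * r).
  { rewrite Rabs_mult; pose proof (Rabs_pos ex); nra. }
  assert (T2 : Rabs ((1 + x) * ec) <= 2 * (eps / 6 * r)).
  { rewrite Rabs_mult.
    assert (Rabs (1 + x) <= 2).
    { eapply Rle_trans; [apply Rabs_triang|]; rewrite Rabs_R1; lra. }
    pose proof (Rabs_pos (1 + x)); pose proof (Rabs_pos ec); nra. }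
  assert (T3 : Rabs ((ex + x) * sin y) <= 2 * (eps / 6 * r)).
  { rewrite Rabs_mult.
    assert (H4 : Rabs (ex + x) <= 2 * r)
      by (eapply Rle_trans; [apply Rabs_triang|lra]).
    assert (H5 : Rabs (sin y) <= 2 * r).
    { replace (sin y) with (es + y) by (unfold es; ring).
      eapply Rle_trans; [apply Rabs_triang|lra]. }
    pose proof (Rabs_pos (ex + x)); pose proof (Rabs_pos (sin y)); nra. }
  pose proof (Rabs_triang (ex * cos y) ((1 + x) * ec)).
  pose proof (Rabs_triang ((ex + x) * sin y) es).
  lra.
Qed.

Lemma C_diff_Cexp (z : C) : C_diff Cexp z (Cexp z).
Proof.
  apply (C_diff_ext_loc (fun w => Cexp z * Cexp (- z + 1 * w))%C _ z _ 1 Rlt_0_1).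
  { intros w _; rewrite <- Cexp_plus; f_equal; ring. }
  eapply C_diff_eq.
  - apply C_diff_mult_const.
    apply (C_diff_comp Cexp (fun w => - z + 1 * w)%C); [apply C_diff_affine|].
    replace (- z + 1 * z)%C with (RtoC 0) by ring; apply C_diff_Cexp_0.
  - ring.
Qed.

Lemma Cexp_2PI (x : R) : Cexp (x, 2 * PI) = Cexp (x, 0).
Proof. unfold Cexp; simpl; rewrite cos_2PI, sin_2PI, cos_0, sin_0; reflexivity. Qed.

Lemma Cexp_unit_mult (r t : R) : 0 < r ->
  Cexp (ln r, t) = (RtoC r * Cexp (0, t))%C.
Proof.
  intros Hr; unfold Cexp; rewrite real_multiple; simpl.
  rewrite exp_ln, exp_0 by exact Hr; f_equal; ring.
Qed.

(** * Goursat's theorem *)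

Lemma continuous_horizontal (f : C -> C) (x y : R) : C_cont f (x, y) ->
  continuous (fun t => fst (f (t, y))) x /\ continuous (fun t => snd (f (t, y))) x.
Proof.
  intros H; split; apply continuity_pt_filterlim; intros eps He;
    destruct (H eps He) as [d [Hd H1]]; exists d; split; try exact Hd;
    intros t [_ Ht]; simpl in *; unfold Rdist in *;
    (eapply Rle_lt_trans;
      [|apply (H1 (t, y)); eapply Rle_lt_trans; [apply Cmod_le_abs|simpl];
        replace (y + - y) with 0 by ring; rewrite Rabs_R0, Rplus_0_r; exact Ht]).
  - apply (Rabs_fst_Cmod (f (t, y) - f (x, y))%C).
  - apply (Rabs_snd_Cmod (f (t, y) - f (x, y))%C).
Qed.

Lemma continuous_vertical (f : C -> C) (x y : R) : C_cont f (x, y) ->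
  continuous (fun t => fst (f (x, t))) y /\ continuous (fun t => snd (f (x, t))) y.
Proof.
  intros H; split; apply continuity_pt_filterlim; intros eps He;
    destruct (H eps He) as [d [Hd H1]]; exists d; split; try exact Hd;
    intros t [_ Ht]; simpl in *; unfold Rdist in *;
    (eapply Rle_lt_trans;
      [|apply (H1 (x, t)); eapply Rle_lt_trans; [apply Cmod_le_abs|simpl];
        replace (x + - x) with 0 by ring; rewrite Rabs_R0, Rplus_0_l; exact Ht]).
  - apply (Rabs_fst_Cmod (f (x, t) - f (x, y))%C).
  - apply (Rabs_snd_Cmod (f (x, t) - f (x, y))%C).
Qed.

(* Imaginary part of the integral of [f(z) dz] around the rectangle. *)
Definition boundary_Im (f : C -> C) (a b c d : R) : R :=
  RInt (fun x => snd (f (x, c))) a b - RInt (fun x => snd (f (x, d))) a b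
  + (RInt (fun y => fst (f (b, y))) c d - RInt (fun y => fst (f (a, y))) c d).

Lemma ex_RInt_hor (f : C -> C) (a b y : R) : a <= b ->
  (forall x, a <= x <= b -> C_cont f (x, y)) ->
  ex_RInt (fun x => snd (f (x, y))) a b.
Proof.
  intros Hab Hf; apply (ex_RInt_continuous (V := R_CompleteNormedModule)).
  intros x Hx; rewrite Rmin_left, Rmax_right in Hx by lra.
  exact (proj2 (continuous_horizontal f x y (Hf x Hx))).
Qed.

Lemma ex_RInt_vert (f : C -> C) (x c d : R) : c <= d ->
  (forall y, c <= y <= d -> C_cont f (x, y)) ->
  ex_RInt (fun y => fst (f (x, y))) c d.
Proof.
  intros Hcd Hf; apply (ex_RInt_continuous (V := R_CompleteNormedModule)).
  intros y Hy; rewrite Rmin_left, Rmax_right in Hy by lra.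
  exact (proj1 (continuous_vertical f x y (Hf y Hy))).
Qed.

Lemma RInt_split (g : R -> R) (a m b : R) : ex_RInt g a m -> ex_RInt g m b ->
  RInt g a b = RInt g a m + RInt g m b.
Proof. intros H1 H2; symmetry; exact (RInt_Chasles g a m b H1 H2). Qed.

(** For opposite sides of a rectangle, [k] is the difference that the linear approximation predicts;
    with [h = 0] the lemma compares a circle integral with the value at the centre. *)
Lemma RInt_diff_bound (g h : R -> R) (a b k M : R) : a <= b ->
  ex_RInt g a b -> ex_RInt h a b ->
  (forall t, a <= t <= b -> Rabs (g t - h t - k) <= M) ->
  Rabs (RInt g a b - RInt h a b - k * (b - a)) <= (b - a) * M.
Proof.
  intros Hab Hg Hh H.
  assert (Hk : ex_RInt (fun _ : R => k) a b) by apply ex_RInt_const.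
  assert (E : RInt (fun t => g t - h t - k) a b = RInt g a b - RInt h a b - k * (b - a)).
  { apply is_RInt_unique.
    replace (RInt g a b - RInt h a b - k * (b - a))
      with (minus (minus (RInt g a b) (RInt h a b)) (scal (b - a) k))
      by (unfold minus, plus, opp, scal; simpl; unfold mult; simpl; ring).
    apply (is_RInt_minus (V := R_NormedModule) (fun t => g t - h t) (fun _ => k)).
    - apply (is_RInt_minus (V := R_NormedModule) g h);
        apply (RInt_correct (V := R_CompleteNormedModule)); assumption.
    - apply (is_RInt_const (V := R_NormedModule)). }
  rewrite <- E; apply abs_RInt_le_const; [exact Hab| |exact H].
  apply (ex_RInt_minus (V := R_NormedModule) (fun t => g t - h t) (fun _ => k));
    [apply (ex_RInt_minus (V := R_NormedModule) g h)|]; assumption.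
Qed.

(** The boundary integral is additive under quartering. On a small box differentiability replaces
    [f] by an affine function, whose boundary integral is 0, with an error of order [eps] times the
    squared size. *)
Lemma goursat (f : C -> C) (a0 b0 c0 d0 : R) : a0 <= b0 -> c0 <= d0 ->
  (forall x y, a0 <= x <= b0 -> c0 <= y <= d0 -> exists l, C_diff f (x, y) l) ->
  boundary_Im f a0 b0 c0 d0 = 0.
Proof.
  intros Hab0 Hcd0 Hf.
  assert (Hcont : forall x y, a0 <= x <= b0 -> c0 <= y <= d0 -> C_cont f (x, y)).
  { intros x y Hx Hy; destruct (Hf x y Hx Hy) as [l Hl]; apply (C_diff_cont _ _ _ Hl). }
  assert (Hbound : forall eps, 0 < eps ->
    Rabs (boundary_Im f a0 b0 c0 d0) <= eps * ((b0 - a0) + (d0 - c0)) ^ 2).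
  { intros eps He.
    set (P := fun a b c d => a0 <= a -> b <= b0 -> c0 <= c -> d <= d0 ->
      Rabs (boundary_Im f a b c d) <= eps * ((b - a) + (d - c)) ^ 2).
    enough (HP : P a0 b0 c0 d0) by (apply HP; lra).
    apply box_induction; try assumption.
    - intros a b c d Hab Hcd m n P1 P2 P3 P4 Ha Hb Hc Hd.
      assert (Hm : m = (a + b) / 2) by reflexivity.
      assert (Hn : n = (c + d) / 2) by reflexivity.
      clearbody m n.
      specialize (P1 ltac:(lra) ltac:(lra) ltac:(lra) ltac:(lra)).
      specialize (P2 ltac:(lra) ltac:(lra) ltac:(lra) ltac:(lra)).
      specialize (P3 ltac:(lra) ltac:(lra) ltac:(lra) ltac:(lra)).
      specialize (P4 ltac:(lra) ltac:(lra) ltac:(lra) ltac:(lra)).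
      assert (E : boundary_Im f a b c d = boundary_Im f a m c n + boundary_Im f m b c n
        + boundary_Im f a m n d + boundary_Im f m b n d).
      { unfold boundary_Im.
        rewrite (RInt_split (fun x => snd (f (x, c))) a m b),
          (RInt_split (fun x => snd (f (x, d))) a m b),
          (RInt_split (fun y => fst (f (b, y))) c n d),
          (RInt_split (fun y => fst (f (a, y))) c n d).
        1: ring.
        all: match goal with
          | |- ex_RInt (fun x => snd _) _ _ => apply (ex_RInt_hor f)
          | _ => apply (ex_RInt_vert f) end; intros; try apply Hcont; lra. }
      rewrite E.
      (* Halving both sides quarters the square, so the four bounds add up to the bound for the
         whole box without loss. *)
      assert (E2 : eps * ((m - a) + (n - c)) ^ 2 + eps * ((b - m) + (n - c)) ^ 2
        + eps * ((m - a) + (d - n)) ^ 2 + eps * ((b - m) + (d - n)) ^ 2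
        = eps * ((b - a) + (d - c)) ^ 2) by (subst m n; field).
      rewrite <- E2.
      eapply Rle_trans; [apply Rabs_triang|apply Rplus_le_compat; [|exact P4]].
      eapply Rle_trans; [apply Rabs_triang|apply Rplus_le_compat; [|exact P3]].
      eapply Rle_trans; [apply Rabs_triang|apply Rplus_le_compat; [exact P1|exact P2]].
    - intros x y Hx Hy.
      destruct (Hf x y Hx Hy) as [l Hl].
      destruct (Hl (eps / 2)) as [e [He' H]]; [lra|].
      exists (e / 2); split; [lra|].
      intros a b c d Hax Hcy Hba Hdc Ha Hb Hc Hd.
      set (D := (b - a) + (d - c)).
      assert (HD : forall s t, a <= s <= b -> c <= t <= d ->
        Cmod ((s, t) - (x, y))%C <= D).
      { intros s t Hs Ht; eapply Rle_trans; [apply Cmod_le_abs|simpl].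
        unfold D; apply Rplus_le_compat; apply Rabs_le; lra. }
      assert (Herr : forall s t, a <= s <= b -> c <= t <= d ->
        Cmod (f (s, t) - f (x, y) - l * ((s, t) - (x, y)))%C <= eps / 2 * D).
      { intros s t Hs Ht; specialize (HD s t Hs Ht).
        eapply Rle_trans; [apply H; unfold D in HD; lra|].
        apply Rmult_le_compat_l; lra. }
      destruct l as [la lb].
      (* The linear part contributes [la * (c - d) * (b - a)] here and the opposite amount on the
         vertical sides in [Hv]. *)
      assert (Hh : Rabs (RInt (fun s => snd (f (s, c))) a b
        - RInt (fun s => snd (f (s, d))) a b - (la * (c - d)) * (b - a))
        <= (b - a) * (eps * D)).
      { apply RInt_diff_bound; [lra|apply (ex_RInt_hor f); intros; try apply Hcont; lra
        |apply (ex_RInt_hor f); intros; try apply Hcont; lra|].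
        intros s Hs.
        assert (K1 := Rle_trans _ _ _ (Rabs_snd_Cmod _) (Herr s c Hs ltac:(lra))).
        assert (K2 := Rle_trans _ _ _ (Rabs_snd_Cmod _) (Herr s d Hs ltac:(lra))).
        simpl in K1, K2.
        apply Rabs_le_between in K1; apply Rabs_le_between in K2; apply Rabs_le; lra. }
      assert (Hv : Rabs (RInt (fun t => fst (f (b, t))) c d
        - RInt (fun t => fst (f (a, t))) c d - (la * (b - a)) * (d - c))
        <= (d - c) * (eps * D)).
      { apply RInt_diff_bound; [lra|apply (ex_RInt_vert f); intros; try apply Hcont; lra
        |apply (ex_RInt_vert f); intros; try apply Hcont; lra|].
        intros t Ht.
        assert (K1 := Rle_trans _ _ _ (Rabs_fst_Cmod _) (Herr b t ltac:(lra) Ht)).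
        assert (K2 := Rle_trans _ _ _ (Rabs_fst_Cmod _) (Herr a t ltac:(lra) Ht)).
        simpl in K1, K2.
        apply Rabs_le_between in K1; apply Rabs_le_between in K2; apply Rabs_le; lra. }
      unfold boundary_Im; fold D.
      replace (eps * D ^ 2) with ((b - a) * (eps * D) + (d - c) * (eps * D))
        by (unfold D; ring).
      apply Rabs_le_between in Hh; apply Rabs_le_between in Hv; apply Rabs_le; lra. }
  destruct (Req_dec (boundary_Im f a0 b0 c0 d0) 0) as [E|E]; [exact E|exfalso].
  assert (Hp : 0 < Rabs (boundary_Im f a0 b0 c0 d0)) by (apply Rabs_pos_lt, E).
  set (J := Rabs (boundary_Im f a0 b0 c0 d0)) in *.
  set (S := ((b0 - a0) + (d0 - c0)) ^ 2) in *.
  assert (HS : 0 <= S) by apply pow2_ge_0.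
  specialize (Hbound (J / (2 * (S + 1)))).
  assert (H1 : 0 < J / (2 * (S + 1))) by (apply Rdiv_lt_0_compat; lra).
  specialize (Hbound H1).
  assert (H2 : J / (2 * (S + 1)) * (2 * (S + 1)) = J) by (field; lra).
  nra.
Qed.

(** * Mean values over circles *)

Lemma continuous_circle (f : C -> C) (s t : R) : C_cont f (Cexp (s, t)) ->
  continuous (fun y => fst (f (Cexp (s, y)))) t.
Proof.
  intros H; refine (proj1 (continuous_vertical (fun w => f (Cexp w)) s t _)).
  apply C_cont_comp; [apply (C_diff_cont _ _ _ (C_diff_Cexp _))|exact H].
Qed.

(** Goursat for [f] composed with [Cexp] on a rectangle of height [2 * PI]: the vertical sides map
    to the two circles, and the horizontal sides cancel by periodicity. *)
Lemma circle_integral_eq (f : C -> C) (s1 s2 : R) : s1 <= s2 ->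
  (forall z, z <> RtoC 0 -> Cmod z <= exp s2 -> exists l, C_diff f z l) ->
  RInt (fun t => fst (f (Cexp (s1, t)))) 0 (2 * PI)
  = RInt (fun t => fst (f (Cexp (s2, t)))) 0 (2 * PI).
Proof.
  intros Hs Hf; pose proof PI_RGT_0.
  assert (G : boundary_Im (fun w => f (Cexp w)) s1 s2 0 (2 * PI) = 0).
  { apply goursat; [lra|lra|].
    intros x y Hx Hy.
    destruct (Hf (Cexp (x, y))) as [l Hl]; [apply Cexp_neq_0| |].
    - rewrite Cmod_Cexp; simpl.
      destruct (Rle_lt_or_eq_dec x s2) as [H1| ->]; try lra.
      apply Rlt_le, exp_increasing, H1.
    - exists (l * Cexp (x, y))%C.
      apply (C_diff_comp f Cexp); [apply C_diff_Cexp|exact Hl]. }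
  unfold boundary_Im in G.
  rewrite (RInt_ext (fun x => snd (f (Cexp (x, 2 * PI)))) (fun x => snd (f (Cexp (x, 0)))))
    in G by (intros; rewrite Cexp_2PI; reflexivity).
  lra.
Qed.

(** Shrink the inner circle in [circle_integral_eq]; continuity at 0 then identifies the mean. *)
Lemma circle_mean (f : C -> C) (r : R) : 0 < r ->
  (forall z, z <> RtoC 0 -> Cmod z <= r -> exists l, C_diff f z l) ->
  C_cont f 0 ->
  RInt (fun t => fst (f (Cexp (ln r, t)))) 0 (2 * PI) = 2 * PI * fst (f 0).
Proof.
  intros Hr Hf H0; pose proof PI_RGT_0 as HPI.
  set (I := RInt (fun t => fst (f (Cexp (ln r, t)))) 0 (2 * PI)).
  assert (Hall : forall eps, 0 < eps -> Rabs (I - 2 * PI * fst (f 0)) <= 2 * PI * eps).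
  { intros eps He.
    destruct (H0 eps He) as [d [Hd H1]].
    set (s := Rmin (ln r) (ln (d / 2))).
    assert (Hs : exp s < d).
    { apply Rle_lt_trans with (exp (ln (d / 2))).
      - destruct (Rle_lt_or_eq_dec s (ln (d / 2)) (Rmin_r _ _)) as [K|K];
          [apply Rlt_le, exp_increasing, K|rewrite K; lra].
      - rewrite exp_ln; lra. }
    assert (Hsr : exp s <= r).
    { rewrite <- (exp_ln r) at 1 by exact Hr.
      destruct (Rle_lt_or_eq_dec s (ln r) (Rmin_l _ _)) as [K|K];
        [apply Rlt_le, exp_increasing, K|rewrite K; lra]. }
    unfold I; rewrite <- (circle_integral_eq f s (ln r));
      [|apply Rmin_l|rewrite exp_ln by exact Hr; exact Hf].
    assert (Hex : ex_RInt (fun t => fst (f (Cexp (s, t)))) 0 (2 * PI)).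
    { apply (ex_RInt_continuous (V := R_CompleteNormedModule)); intros t _.
      destruct (Hf (Cexp (s, t))) as [l Hl];
        [apply Cexp_neq_0|rewrite Cmod_Cexp; exact Hsr|].
      apply continuous_circle, (C_diff_cont _ _ _ Hl). }
    pose proof (RInt_diff_bound (fun t => fst (f (Cexp (s, t)))) (fun _ => 0)
      0 (2 * PI) (fst (f 0)) eps ltac:(lra) Hex) as HB.
    assert (Hz : RInt (fun _ : R => 0) 0 (2 * PI) = 0).
    { rewrite RInt_const; unfold scal; simpl; unfold mult; simpl; ring. }
    rewrite Hz in HB.
    match goal with |- Rabs (?A - _) <= _ =>
      replace (A - 2 * PI * fst (f 0)) with (A - 0 - fst (f 0) * (2 * PI - 0)) by ring end.
    replace (2 * PI * eps) with ((2 * PI - 0) * eps) by ring.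
    apply HB; [apply ex_RInt_const|].
    intros t _; rewrite Rminus_0_r; apply Rlt_le.
    eapply Rle_lt_trans; [apply (Rabs_fst_Cmod (f (Cexp (s, t)) - f 0)%C)|].
    apply H1; replace (Cexp (s, t) - 0)%C with (Cexp (s, t)) by ring.
    rewrite Cmod_Cexp; exact Hs. }
  destruct (Req_dec (I - 2 * PI * fst (f 0)) 0) as [E|E]; [lra|exfalso].
  apply Rabs_pos_lt in E.
  specialize (Hall (Rabs (I - 2 * PI * fst (f 0)) / (4 * PI))).
  assert (E2 : 2 * PI * (Rabs (I - 2 * PI * fst (f 0)) / (4 * PI))
    = Rabs (I - 2 * PI * fst (f 0)) / 2) by (field; lra).
  rewrite E2 in Hall.
  assert (0 < Rabs (I - 2 * PI * fst (f 0)) / (4 * PI)) by (apply Rdiv_lt_0_compat; lra).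
  specialize (Hall H); lra.
Qed.

(* Allowing a singularity at the centre lets the lemma apply to difference
   quotients. *)
Lemma maximum_principle (f : C -> C) (r M : R) : 0 < r ->
  (forall z, z <> RtoC 0 -> Cmod z <= r -> exists l, C_diff f z l) ->
  C_cont f 0 ->
  (forall z, Cmod z = r -> Cmod (f z) <= M) -> Cmod (f 0) <= M.
Proof.
  intros Hr Hf H0 HM.
  assert (HM0 : 0 <= M).
  { eapply Rle_trans; [apply Cmod_ge_0|apply (HM (RtoC r))].
    rewrite Cmod_R; apply Rabs_pos_eq; lra. }
  (* After this rotation the value at the centre is its own modulus, so the mean value of the real
     part suffices. *)
  destruct (rotate_to_real (f 0)) as [c [Hc Hc0]]; pose proof (Cmod_ge_0 (f 0)) as Hge.
  pose proof (circle_mean (fun z => c * f z)%C r Hr) as Hmean.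
  pose proof PI_RGT_0 as HPI.
  assert (Hdc : forall z, z <> RtoC 0 -> Cmod z <= r -> exists l, C_diff (fun z => c * f z)%C z l).
  { intros z Hz Hzr; destruct (Hf z Hz Hzr) as [l Hl].
    exists (c * l)%C; apply C_diff_mult_const, Hl. }
  assert (Hcc : C_cont (fun z => c * f z)%C 0).
  { intros eps He; destruct (H0 eps He) as [d [Hd H]]; exists d; split; [exact Hd|].
    intros w Hw; replace (c * f w - c * f 0)%C with (c * (f w - f 0))%C by ring.
    rewrite Cmod_mult, Hc, Rmult_1_l; apply H, Hw. }
  specialize (Hmean Hdc Hcc); cbv beta in Hmean; rewrite Hc0 in Hmean.
  change (fst (RtoC (Cmod (f 0)))) with (Cmod (f 0)) in Hmean.
  assert (HI : Rabs (RInt (fun t => fst (c * f (Cexp (ln r, t)))%C) 0 (2 * PI))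
    <= (2 * PI - 0) * M).
  { apply abs_RInt_le_const; [lra| |].
    - apply (ex_RInt_continuous (V := R_CompleteNormedModule)); intros t _.
      destruct (Hdc (Cexp (ln r, t))) as [l Hl]; [apply Cexp_neq_0| |].
      + rewrite Cmod_Cexp; simpl; rewrite exp_ln; lra.
      + apply (continuous_circle (fun z => c * f z)%C), (C_diff_cont _ _ _ Hl).
    - intros t _; eapply Rle_trans; [apply Rabs_fst_Cmod|].
      rewrite Cmod_mult, Hc, Rmult_1_l; apply HM.
      rewrite Cmod_Cexp; simpl; apply exp_ln, Hr. }
  rewrite Hmean, Rabs_pos_eq in HI by nra.
  nra.
Qed.

(** The maximum principle for the difference quotient, given the value [l] at the centre, where only
    its continuity is known. *)
Lemma cauchy_estimate (f : C -> C) (z0 l : C) (r M : R) : 0 < r ->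
  (forall z, Cmod (z - z0) <= r -> exists l, C_diff f z l) ->
  C_diff f z0 l ->
  (forall z, Cmod (z - z0) = r -> Cmod (f z - f z0) <= M) ->
  Cmod l <= M / r.
Proof.
  intros Hr Hf Hl HM.
  assert (Hg0 : forall z : C, Cmod (z0 + 1 * z - z0)%C = Cmod z)
    by (intros z; f_equal; ring).
  set (g := fun z : C => if excluded_middle_informative (z = RtoC 0) then l
    else ((f (z0 + 1 * z) - f z0) / z)%C).
  assert (Hne : forall z, z <> RtoC 0 -> g z = ((f (z0 + 1 * z) - f z0) / z)%C).
  { intros z Hz; unfold g; destruct excluded_middle_informative; [contradiction|reflexivity]. }
  assert (E0 : g 0 = l).
  { unfold g; destruct excluded_middle_informative as [|K]; [reflexivity|].
    exfalso; apply K; reflexivity. }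
  rewrite <- E0.
  apply (maximum_principle g r); [exact Hr| | |].
  - intros z Hz Hzr.
    destruct (Hf (z0 + 1 * z)%C) as [m Hm]; [rewrite Hg0; exact Hzr|].
    eexists.
    apply (C_diff_ext_loc (fun w => (f (z0 + 1 * w) - f z0) * / w)%C _ z _ (Cmod z)).
    + apply Cmod_gt_0, Hz.
    + intros w Hw; rewrite Hne; [reflexivity|].
      intros ->; rewrite Cmod_minus_sym in Hw.
      replace (z - 0)%C with z in Hw by ring; lra.
    + apply C_diff_mult.
      * apply C_diff_minus; [|apply C_diff_const].
        apply (C_diff_comp f (fun w => z0 + 1 * w)%C); [apply C_diff_affine|exact Hm].
      * apply C_diff_Cinv, Hz.
  - intros eps He; destruct (Hl (eps / 2)) as [d [Hd H]]; [lra|].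
    exists d; split; [exact Hd|]; intros w Hw.
    replace (w - 0)%C with w in Hw by ring.
    rewrite E0.
    destruct (classic (w = RtoC 0)) as [->|Hw0].
    { rewrite E0; replace (l - l)%C with (RtoC 0) by ring; rewrite Cmod_0; exact He. }
    rewrite Hne by exact Hw0.
    assert (Hwp : 0 < Cmod w) by (apply Cmod_gt_0, Hw0).
    specialize (H (z0 + 1 * w)%C); rewrite Hg0 in H; specialize (H Hw).
    replace ((f (z0 + 1 * w) - f z0) / w - l)%C
      with ((f (z0 + 1 * w) - f z0 - l * (z0 + 1 * w - z0)) / w)%C by (field; exact Hw0).
    rewrite Cmod_div by exact Hw0.
    apply Rle_lt_trans with (eps / 2); [|lra].
    apply Rmult_le_reg_r with (Cmod w); [exact Hwp|].
    unfold Rdiv at 1; rewrite Rmult_assoc, Rinv_l by lra; lra.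
  - intros z Hz.
    assert (Hz0 : z <> RtoC 0) by (apply Cmod_gt_0; lra).
    rewrite Hne, Cmod_div, Hz by assumption.
    apply Rmult_le_compat_r; [apply Rlt_le, Rinv_0_lt_compat, Hr|].
    apply HM; rewrite Hg0; exact Hz.
Qed.

(* Schwarz-Pick for the right half-plane: the Cauchy estimate for the Cayley
   transform of [f]. *)
Lemma half_plane_derivative (f : C -> C) (z0 l : C) (r : R) : 0 < r ->
  (forall z, Cmod (z - z0) <= r -> exists l, C_diff f z l) ->
  C_diff f z0 l ->
  (forall z, Cmod (z - z0) <= r -> 0 < fst (f z)) ->
  Cmod l <= 2 * fst (f z0) / r.
Proof.
  intros Hr Hf Hl Hpos.
  assert (Hc : Cmod (z0 - z0) <= r)
    by (replace (z0 - z0)%C with (RtoC 0) by ring; rewrite Cmod_0; lra).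
  set (a := f z0) in *.
  assert (Ha : 0 < fst a) by (apply Hpos, Hc).
  assert (Hden : forall z, Cmod (z - z0) <= r -> (f z + Cconj a)%C <> RtoC 0).
  { intros z Hz K; specialize (Hpos z Hz).
    apply (f_equal fst) in K; simpl in K; lra. }
  set (k := fun z => ((f z - a) * / (f z + Cconj a))%C).
  assert (Hk : forall z m, Cmod (z - z0) <= r -> C_diff f z m ->
    C_diff k z ((m - 0) * / (f z + Cconj a)
      + (f z - a) * (- (m + 0) / ((f z + Cconj a) * (f z + Cconj a))))%C).
  { intros z m Hz Hm.
    apply (C_diff_mult (fun w => f w - a)%C (fun w => / (f w + Cconj a))%C).
    - apply C_diff_minus; [exact Hm|apply C_diff_const].
    - apply (C_diff_inv (fun w => f w + Cconj a)%C); [apply Hden, Hz|].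
      apply C_diff_plus; [exact Hm|apply C_diff_const]. }
  assert (Hk0 : C_diff k z0 (l / RtoC (2 * fst a))).
  { eapply C_diff_eq; [apply Hk; [exact Hc|exact Hl]|].
    specialize (Hden z0 Hc); fold a in Hden |- *.
    replace (RtoC (2 * fst a)) with (a + Cconj a)%C
      by (apply injective_projections; simpl; ring).
    field; exact Hden. }
  assert (Hm : Cmod (l / RtoC (2 * fst a))%C <= 1 / r).
  { apply (cauchy_estimate k z0 _ r 1 Hr); [|exact Hk0|].
    - intros z Hz; destruct (Hf z Hz) as [m Hm]; eexists; apply Hk; eassumption.
    - intros z Hz.
      assert (Hz' : Cmod (z - z0) <= r) by lra.
      replace (k z - k z0)%C with (k z) by (unfold k; fold a; ring).
      unfold k; specialize (Hden z Hz'); specialize (Hpos z Hz').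
      fold (Cdiv (f z - a) (f z + Cconj a)); rewrite Cmod_div by exact Hden.
      assert (Hd : 0 < Cmod (f z + Cconj a)) by (apply Cmod_gt_0, Hden).
      apply Rmult_le_reg_r with (Cmod (f z + Cconj a)); [exact Hd|].
      unfold Rdiv; rewrite Rmult_assoc, Rinv_l, Rmult_1_r, Rmult_1_l by lra.
      (* The squared moduli of [f z + Cconj a] and [f z - a] differ by four times the product of the
         real parts of [f z] and [a], which is positive. *)
      unfold Cmod; apply sqrt_le_1_alt; simpl; nra. }
  assert (H2 : RtoC (2 * fst a) <> RtoC 0) by (intros K; apply RtoC_inj in K; lra).
  rewrite Cmod_div, Cmod_R, Rabs_pos_eq in Hm by (exact H2 || lra).
  apply (Rmult_le_compat_r (2 * fst a)) in Hm; [|lra].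
  replace (Cmod l / (2 * fst a) * (2 * fst a)) with (Cmod l) in Hm by (field; lra).
  replace (2 * fst a / r) with (1 / r * (2 * fst a)) by (field; lra).
  exact Hm.
Qed.

(** * Compactness of closed disks *)

(** Heine-Borel as an induction principle over sets, so that boundedness, uniform continuity and
    compactness all follow from one bisection. *)
Lemma closed_disk_induction (Q : (C -> Prop) -> Prop) (z0 : C) (r : R) :
  (forall A B : C -> Prop, (forall z, A z -> B z) -> Q B -> Q A) ->
  (forall A B : C -> Prop, Q A -> Q B -> Q (fun z => A z \/ B z)) ->
  (forall z, Cmod (z - z0) <= r -> exists d, 0 < d /\ Q (fun w => Cmod (w - z) < d)) ->
  Q (fun _ => False) -> 0 <= r -> Q (fun z => Cmod (z - z0) <= r).
Proof.
  intros Hmono Hunion Hloc Hempty Hr.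
  set (box := fun a b c d (z : C) => a <= fst z <= b /\ c <= snd z <= d).
  set (P := fun a b c d => Q (fun z => box a b c d z /\ Cmod (z - z0) <= r)).
  enough (HP : P (fst z0 - r) (fst z0 + r) (snd z0 - r) (snd z0 + r)).
  { apply (Hmono _ _) with (2 := HP); intros z Hz; split; [|exact Hz].
    assert (K1 := proj1 (Rabs_le_between _ _) (Rle_trans _ _ _ (Rabs_fst_Cmod (z - z0)) Hz)).
    assert (K2 := proj1 (Rabs_le_between _ _) (Rle_trans _ _ _ (Rabs_snd_Cmod (z - z0)) Hz)).
    simpl in K1, K2; split; lra. }
  apply box_induction; [| |lra|lra].
  - intros a b c d Hab Hcd m n P1 P2 P3 P4.
    unfold P.
    pose proof (Hunion _ _ (Hunion _ _ P1 P2) (Hunion _ _ P3 P4)) as H.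
    apply (Hmono _ _) with (2 := H); intros z [[Hz1 Hz2] Hz].
    unfold box.
    destruct (Rle_dec (fst z) m); destruct (Rle_dec (snd z) n).
    + left; left; repeat split; lra.
    + right; left; repeat split; lra.
    + left; right; repeat split; lra.
    + right; right; repeat split; lra.
  - intros x y _ _.
    assert (Hnear : forall a b c d z, a <= x <= b -> c <= y <= d -> box a b c d z ->
      Cmod (z - (x, y)) <= (b - a) + (d - c)).
    { intros a b c d [z1 z2] Hx Hy [H1 H2]; simpl in H1, H2.
      eapply Rle_trans; [apply Cmod_le_abs|simpl].
      apply Rplus_le_compat; apply Rabs_le; lra. }
    destruct (Rle_dec (Cmod ((x, y) - z0)) r) as [Hin|Hout].
    + destruct (Hloc _ Hin) as [d [Hd HQ]].
      exists (d / 2); split; [lra|].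
      intros a b c d' Hx Hy Hba Hdc.
      apply (Hmono _ _) with (2 := HQ); intros z [Hz _].
      specialize (Hnear _ _ _ _ z Hx Hy Hz); lra.
    (* A small box around a point outside the disk misses the disk, so the property of the empty set
       applies. *)
    + exists ((Cmod ((x, y) - z0) - r) / 2); split; [lra|].
      intros a b c d' Hx Hy Hba Hdc.
      apply (Hmono _ _) with (2 := Hempty); intros z [Hz Hzr].
      specialize (Hnear _ _ _ _ z Hx Hy Hz).
      pose proof (Cmod_minus_triangle (x, y) z z0) as Ht.
      rewrite (Cmod_minus_sym (x, y) z) in Ht; lra.
Qed.

Lemma closed_disk_bounded (h : C -> C) (z0 : C) (r : R) : 0 <= r ->
  (forall z, Cmod (z - z0) <= r -> C_cont h z) ->
  exists M, forall z, Cmod (z - z0) <= r -> Cmod (h z) <= M.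
Proof.
  intros Hr Hh.
  apply (closed_disk_induction
    (fun A => exists M, forall z, A z -> Cmod (h z) <= M)); [| | | |exact Hr].
  - intros A B HAB [M HM]; exists M; auto.
  - intros A B [M HM] [N HN]; exists (Rmax M N); intros z [Hz|Hz].
    + eapply Rle_trans; [apply HM, Hz|apply Rmax_l].
    + eapply Rle_trans; [apply HN, Hz|apply Rmax_r].
  - intros z Hz; destruct (Hh z Hz 1 Rlt_0_1) as [d [Hd H]].
    exists d; split; [exact Hd|]; exists (Cmod (h z) + 1); intros w Hw.
    pose proof (Cmod_le_add (h w) (h z)); specialize (H w Hw); lra.
  - exists 0; contradiction.
Qed.

(** Only [z] is confined to the disk: [C_cont] is continuity in the whole plane, so [w] may lie
    outside. *)
Lemma closed_disk_uniformly_continuous (h : C -> C) (z0 : C) (r eps : R) :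
  0 <= r -> 0 < eps -> (forall z, Cmod (z - z0) <= r -> C_cont h z) ->
  exists d, 0 < d /\ forall z w, Cmod (z - z0) <= r -> Cmod (w - z) < d ->
    Cmod (h w - h z) < eps.
Proof.
  intros Hr He Hh.
  apply (closed_disk_induction (fun A => exists d, 0 < d /\ forall z w, A z ->
    Cmod (w - z) < d -> Cmod (h w - h z) < eps)); [| | | |exact Hr].
  - intros A B HAB [d [Hd H]]; exists d; split; [exact Hd|]; auto.
  - intros A B [d [Hd H]] [d' [Hd' H']]; exists (Rmin d d').
    split; [apply Rmin_pos; assumption|].
    intros z w [Hz|Hz] Hw; [apply H|apply H']; try exact Hz;
      (eapply Rlt_le_trans; [exact Hw|]); [apply Rmin_l|apply Rmin_r].
  - intros z Hz; destruct (Hh z Hz (eps / 2)) as [d [Hd H]]; [lra|].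
    exists (d / 2); split; [lra|]; exists (d / 2); split; [lra|].
    intros z' w Hz' Hw.
    pose proof (Cmod_minus_triangle w z' z).
    pose proof (Cmod_minus_triangle (h w) (h z) (h z')) as Ht.
    rewrite (Cmod_minus_sym (h z)) in Ht.
    assert (H1 := H w ltac:(lra)); assert (H2 := H z' ltac:(lra)); lra.
  - exists 1; split; [lra|contradiction].
Qed.

Lemma compact_closed_disk (z0 : C) (r : R) : 0 <= r ->
  compact_subset C_Metric_Space (fun z => Cmod (z - z0) <= r).
Proof.
  intros Hr I U Hopen Hcover.
  apply (closed_disk_induction (fun A => exists l : list I,
    forall x, A x -> exists i, In i l /\ U i x)); [| | | |exact Hr].
  - intros A B HAB [l Hl]; exists l; auto.
  - intros A B [l Hl] [l' Hl']; exists (l ++ l'); intros z [Hz|Hz].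
    + destruct (Hl z Hz) as [i [Hi HU]]; exists i; split; [|exact HU].
      apply in_or_app; left; exact Hi.
    + destruct (Hl' z Hz) as [i [Hi HU]]; exists i; split; [|exact HU].
      apply in_or_app; right; exact Hi.
  - intros z Hz; destruct (Hcover z Hz) as [i Hi].
    destruct (Hopen i z Hi) as [d [Hd H]].
    exists d; split; [exact Hd|]; exists (i :: nil); intros w Hw.
    exists i; split; [left; reflexivity|].
    apply H; simpl; unfold C_dist; rewrite Cmod_minus_sym; exact Hw.
  - exists nil; contradiction.
Qed.

(** * Logarithms of nonvanishing functions *)

Lemma continuous_C_cont (F : C -> C) (z : C) :
  continuous (fun w => fst (F w)) z -> continuous (fun w => snd (F w)) z -> C_cont F z.
Proof.
  intros H1 H2 eps He.
  assert (He2 : 0 < eps / 2) by lra.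
  destruct (proj1 (filterlim_locally _ _) H1 (mkposreal _ He2)) as [d1 K1].
  destruct (proj1 (filterlim_locally _ _) H2 (mkposreal _ He2)) as [d2 K2].
  exists (Rmin d1 d2); split; [apply Rmin_pos; apply cond_pos|].
  intros w Hw.
  assert (Hball : forall d : posreal, Cmod (w - z) < d -> ball z d w).
  { intros d Hd; apply C_NormedModule_mixin_compat1, Hd. }
  specialize (K1 w (Hball _ (Rlt_le_trans _ _ _ Hw (Rmin_l _ _)))).
  specialize (K2 w (Hball _ (Rlt_le_trans _ _ _ Hw (Rmin_r _ _)))).
  eapply Rle_lt_trans; [apply Cmod_le_abs|].
  change (Rabs (fst (F w) - fst (F z)) < eps / 2) in K1.
  change (Rabs (snd (F w) - snd (F z)) < eps / 2) in K2.
  change (Rabs (fst (F w) - fst (F z)) + Rabs (snd (F w) - snd (F z)) < eps); lra.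
Qed.

(** The principal branch where the real part is positive; there the argument is an arctangent. The
    ratios in [logarithm_on_disk] stay in this half-plane. *)
Definition Log (z : C) : C := (ln (Cmod z), atan (snd z / fst z)).

Lemma Cexp_Log (z : C) : 0 < fst z -> Cexp (Log z) = z.
Proof.
  intros Hz.
  assert (Hm : 0 < Cmod z).
  { eapply Rlt_le_trans; [exact Hz|].
    rewrite <- (Rabs_pos_eq (fst z)) by lra; apply Rabs_fst_Cmod. }
  assert (E : sqrt (1 + (snd z / fst z)²) = Cmod z / fst z).
  { rewrite <- (sqrt_Rsqr (Cmod z / fst z)) by (apply Rlt_le, Rdiv_lt_0_compat; lra).
    f_equal; unfold Rsqr.
    replace (Cmod z / fst z * (Cmod z / fst z)) with (Cmod z ^ 2 / (fst z * fst z))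
      by (field; lra).
    rewrite Cmod_sqr; field; lra. }
  unfold Cexp, Log; simpl; rewrite exp_ln, cos_atan, sin_atan, E by exact Hm.
  apply injective_projections; simpl; field; lra.
Qed.

Lemma C_cont_Log (z : C) : 0 < fst z -> C_cont Log z.
Proof.
  intros Hz.
  assert (Hm : 0 < Cmod z).
  { eapply Rlt_le_trans; [exact Hz|].
    rewrite <- (Rabs_pos_eq (fst z)) by lra; apply Rabs_fst_Cmod. }
  apply continuous_C_cont; unfold Log; simpl.
  - apply (continuous_comp Cmod ln); [|apply continuous_ln, Hm].
    unfold Cmod.
    apply (continuous_comp (fun w : C => fst w ^ 2 + snd w ^ 2) sqrt);
      [|apply continuous_sqrt].
    apply (continuous_plus (V := R_NormedModule) (fun x : C => fst x ^ 2)
      (fun x : C => snd x ^ 2)).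
    + apply (continuous_ext (fun x : C => mult (fst x) (fst x))).
      { intros x; simpl; unfold mult; simpl; ring. }
      apply (continuous_mult (K := R_AbsRing)); apply continuous_fst.
    + apply (continuous_ext (fun x : C => mult (snd x) (snd x))).
      { intros x; simpl; unfold mult; simpl; ring. }
      apply (continuous_mult (K := R_AbsRing)); apply continuous_snd.
  - apply (continuous_comp (fun w : C => snd w / fst w) atan); [|apply continuous_atan].
    apply (continuous_mult (K := R_AbsRing)); [apply continuous_snd|].
    apply (continuous_comp (fst : C -> R) Rinv);
      [apply continuous_fst|apply continuous_Rinv; lra].
Qed.

(** A continuous logarithm is differentiable because the derivative of [Cexp] at [b z] is [h z],
    which is nonzero: the expansion of [Cexp] first shows that [b w - b z] is of order [w - z],
    after which its error term is negligible. *)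
Lemma C_diff_logarithm (b h : C -> C) (z l : C) (d0 : R) : 0 < d0 ->
  (forall w, Cmod (w - z) < d0 -> Cexp (b w) = h w) ->
  C_cont b z -> C_diff h z l -> C_diff b z (l / h z).
Proof.
  intros Hd0 Hexp Hb Hh eps He.
  assert (Ez : Cexp (b z) = h z).
  { apply Hexp; replace (z - z)%C with (RtoC 0) by ring; rewrite Cmod_0; exact Hd0. }
  assert (Hz0 : h z <> RtoC 0) by (rewrite <- Ez; apply Cexp_neq_0).
  set (k := Cmod (h z)).
  assert (Hk : 0 < k) by (apply Cmod_gt_0, Hz0).
  pose proof (Cmod_ge_0 l) as Hl.
  set (eta' := Rmin 1 (eps * k / 2)).
  assert (Heta' : 0 < eta') by (apply Rmin_pos; [lra|nra]).
  (* With [eta <= k / 2] the term [eta * X] of [B1] is absorbed into [k * X], which gives the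
     Lipschitz bound [B2]; the second bound then serves [B4]. *)
  set (eta := Rmin (k / 2) (eps * k * k / (4 * (Cmod l + 1)))).
  assert (Heta : 0 < eta).
  { apply Rmin_pos; [lra|apply Rdiv_lt_0_compat; [|lra]].
    repeat apply Rmult_lt_0_compat; assumption. }
  destruct (C_diff_Cexp (b z) eta Heta) as [d1 [Hd1 H1]].
  destruct (Hb d1 Hd1) as [d2 [Hd2 H2]].
  destruct (Hh eta' Heta') as [d3 [Hd3 H3]].
  exists (Rmin d0 (Rmin d2 d3)); split; [repeat apply Rmin_pos; assumption|].
  intros w Hw.
  assert (Hw0 : Cmod (w - z) < d0) by (eapply Rlt_le_trans; [exact Hw|apply Rmin_l]).
  assert (Hw1 : Cmod (w - z) < Rmin d2 d3)
    by (eapply Rlt_le_trans; [exact Hw|apply Rmin_r]).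
  assert (Hw2 : Cmod (w - z) < d2) by (eapply Rlt_le_trans; [exact Hw1|apply Rmin_l]).
  assert (Hw3 : Cmod (w - z) < d3) by (eapply Rlt_le_trans; [exact Hw1|apply Rmin_r]).
  specialize (H1 (b w) (H2 w Hw2)); specialize (H3 w Hw3).
  rewrite Ez, (Hexp w Hw0) in H1.
  set (X := Cmod (b w - b z)) in *; set (Y := Cmod (w - z)) in *.
  assert (HX : 0 <= X) by apply Cmod_ge_0.
  assert (HY : 0 <= Y) by apply Cmod_ge_0.
  assert (B1 : k * X <= eta * X + (eta' * Y + Cmod l * Y)).
  { unfold k, X, Y; rewrite <- !Cmod_mult; fold X Y.
    replace (h z * (b w - b z))%C
      with (- (h w - h z - h z * (b w - b z))
            + ((h w - h z - l * (w - z)) + l * (w - z)))%C by ring.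
    eapply Rle_trans; [apply Cmod_triangle|apply Rplus_le_compat].
    - rewrite Cmod_opp; exact H1.
    - eapply Rle_trans; [apply Cmod_triangle|apply Rplus_le_compat_r; exact H3]. }
  assert (Ha : eta <= k / 2) by apply Rmin_l.
  assert (Hb' : eta' <= 1) by apply Rmin_l.
  assert (B2 : X * k <= 2 * ((Cmod l + 1) * Y)) by nra.
  assert (B3 : k * Cmod (b w - b z - l / h z * (w - z)) <= eta * X + eta' * Y).
  { unfold k; rewrite <- Cmod_mult.
    replace (h z * (b w - b z - l / h z * (w - z)))%C
      with (- (h w - h z - h z * (b w - b z)) + (h w - h z - l * (w - z)))%C
      by (field; exact Hz0).
    eapply Rle_trans; [apply Cmod_triangle|].
    rewrite Cmod_opp; apply Rplus_le_compat; assumption. }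
  assert (B4 : eta * X <= eps * k / 2 * Y).
  { apply Rle_trans with (eps * k * k / (4 * (Cmod l + 1)) * X).
    - apply Rmult_le_compat_r; [exact HX|apply Rmin_r].
    - replace (eps * k * k / (4 * (Cmod l + 1)) * X)
        with (eps * k / (4 * (Cmod l + 1)) * (X * k)) by (field; lra).
      replace (eps * k / 2 * Y)
        with (eps * k / (4 * (Cmod l + 1)) * (2 * ((Cmod l + 1) * Y))) by (field; lra).
      apply Rmult_le_compat_l; [|exact B2].
      apply Rlt_le, Rdiv_lt_0_compat; [nra|lra]. }
  assert (B5 : eta' * Y <= eps * k / 2 * Y)
    by (apply Rmult_le_compat_r; [exact HY|apply Rmin_r]).
  apply Rmult_le_reg_l with k; [exact Hk|lra].
Qed.

Lemma Cexp_circle (x y : R) : x ^ 2 + y ^ 2 = 1 -> exists t, Cexp (0, t) = (x, y).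
Proof.
  intros H.
  assert (Hx : -1 <= x <= 1) by nra.
  assert (Hs : 1 - x² = y²) by (unfold Rsqr; lra).
  unfold Cexp; simpl.
  destruct (Rle_dec 0 y) as [Hy|Hy].
  - exists (acos x); rewrite exp_0, cos_acos, sin_acos, Hs, sqrt_Rsqr by assumption.
    f_equal; ring.
  - exists (- acos x); rewrite exp_0, cos_neg, sin_neg, cos_acos, sin_acos, Hs by assumption.
    replace (y²) with ((- y)²) by (unfold Rsqr; ring).
    rewrite sqrt_Rsqr by lra; f_equal; ring.
Qed.

Lemma Cexp_period (x t : R) (k : Z) : Cexp (x, t + 2 * PI * IZR k) = Cexp (x, t).
Proof.
  assert (Hn : forall (n : nat) s, Cexp (x, s + 2 * PI * INR n) = Cexp (x, s)).
  { intros n s; unfold Cexp; simpl.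
    replace (s + 2 * PI * INR n) with (s + 2 * INR n * PI) by ring.
    rewrite cos_period, sin_period; reflexivity. }
  destruct (Z.le_gt_cases 0 k) as [Hk|Hk].
  - rewrite <- (Z2Nat.id k Hk), <- INR_IZR_INZ; apply Hn.
  - rewrite <- (Hn (Z.to_nat (- k)) (t + 2 * PI * IZR k)).
    rewrite INR_IZR_INZ, Z2Nat.id, opp_IZR by lia.
    f_equal; f_equal; ring.
Qed.

Lemma polar_form (z : C) (y : R) : z <> RtoC 0 ->
  exists t, y <= t < y + 2 * PI /\ Cexp (ln (Cmod z), t) = z.
Proof.
  intros Hz; pose proof PI_RGT_0 as HPI.
  assert (Hm : 0 < Cmod z) by (apply Cmod_gt_0, Hz).
  destruct (Cexp_circle (fst z / Cmod z) (snd z / Cmod z)) as [t Ht].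
  { replace ((fst z / Cmod z) ^ 2 + (snd z / Cmod z) ^ 2)
      with ((fst z ^ 2 + snd z ^ 2) / Cmod z ^ 2) by (field; lra).
    rewrite <- Cmod_sqr; field; lra. }
  set (k := up ((y - t) / (2 * PI))).
  destruct (archimed ((y - t) / (2 * PI))) as [A1 A2]; fold k in A1, A2.
  assert (E : (y - t) / (2 * PI) * (2 * PI) = y - t) by (field; lra).
  assert (Hfin : forall j : Z, Cexp (ln (Cmod z), t + 2 * PI * IZR j) = z).
  { intros j; rewrite Cexp_period, Cexp_unit_mult, Ht, real_multiple by exact Hm.
    apply injective_projections; simpl; field; lra. }
  (* [up] gives a representative in the interval open at [y] and closed at [y + 2 * PI]; in the
     endpoint case one period is subtracted. *)
  destruct (Req_dec (IZR k - (y - t) / (2 * PI)) 1) as [K|K].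
  - exists (t + 2 * PI * IZR (k - 1)); split; [|apply Hfin].
    rewrite minus_IZR; nra.
  - exists (t + 2 * PI * IZR k); split; [|apply Hfin]; nra.
Qed.

(* A continuous branch is built along rays: for a fine enough subdivision the
   ratios of consecutive values [h (j z / n)] lie in the right half-plane. *)
Lemma logarithm_on_disk (h : C -> C) (r : R) : 0 < r ->
  (forall z, Cmod z <= r -> exists l, C_diff h z l) ->
  (forall z, Cmod z <= r -> h z <> RtoC 0) ->
  exists b, forall z, Cmod z < r -> Cexp (b z) = h z /\
    forall l, C_diff h z l -> C_diff b z (l / h z).
Proof.
  intros Hr Hh Hne.
  assert (H0 : forall z : C, Cmod (z - 0) = Cmod z) by (intros z; f_equal; ring).
  assert (Hcont : forall z, Cmod z <= r -> C_cont h z).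
  { intros z Hz; destruct (Hh z Hz) as [l Hl]; apply (C_diff_cont _ _ _ Hl). }
  (* Since [|h| >= 1 / M], an increment of [h] below [1 / M] keeps the ratio of consecutive values
     within distance 1 of 1, hence in the right half-plane. *)
  destruct (closed_disk_bounded (fun z => / h z)%C 0 r) as [M HM]; [lra| |].
  { intros z Hz; rewrite H0 in Hz; destruct (Hh z Hz) as [l Hl].
    eapply C_diff_cont, C_diff_inv; [apply Hne, Hz|exact Hl]. }
  assert (HM0 : 0 < M).
  { eapply Rlt_le_trans; [|apply (HM 0)].
    - apply Cmod_gt_0; intros K; apply (Hne 0); [rewrite Cmod_0; lra|].
      assert (K2 : (h 0 * / h 0)%C = RtoC 0) by (rewrite K; ring).
      rewrite Cinv_r in K2; [apply RtoC_inj in K2; lra|].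
      apply Hne; rewrite Cmod_0; lra.
    - rewrite H0, Cmod_0; lra. }
  destruct (closed_disk_uniformly_continuous h 0 r (/ M)) as [d [Hd Hu]];
    [lra|apply Rinv_0_lt_compat, HM0|intros z Hz; apply Hcont; rewrite <- H0; exact Hz|].
  assert (Hn : exists n, (0 < n)%nat /\ r / INR n < d).
  { destruct (archimed_cor1 (d / r)) as [n [Hn Hn0]]; [apply Rdiv_lt_0_compat; lra|].
    exists n; split; [exact Hn0|].
    apply (Rmult_lt_compat_r r) in Hn; [|exact Hr].
    replace (d / r * r) with d in Hn by (field; lra).
    unfold Rdiv; lra. }
  destruct Hn as [n [Hn0 Hn]].
  assert (HnR : 0 < INR n) by (apply lt_0_INR, Hn0).
  set (node := fun (j : nat) (z : C) => (RtoC (INR j / INR n) * z)%C).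
  assert (Hnode : forall j z, (j <= n)%nat -> Cmod (node j z) <= Cmod z).
  { intros j z Hj; unfold node.
    assert (Hj1 : 0 <= INR j / INR n <= 1).
    { split; [apply Rmult_le_pos; [apply pos_INR|apply Rlt_le, Rinv_0_lt_compat, HnR]|].
      apply Rmult_le_reg_r with (INR n); [exact HnR|].
      unfold Rdiv; rewrite Rmult_assoc, Rinv_l, Rmult_1_r, Rmult_1_l by lra.
      apply le_INR, Hj. }
    rewrite Cmod_RtoC_mult by lra; pose proof (Cmod_ge_0 z); nra. }
  assert (Hnodec : forall j z, C_cont (node j) z).
  { intros j z; eapply C_diff_cont; unfold node; apply C_diff_mult_const, C_diff_id. }
  (* The branch for [j] is a logarithm of [h (j z / n)]: constant for [j = 0], and of [h] itself for
     [j = n]. *)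
  assert (Hb : forall j, (j <= n)%nat -> exists b : C -> C,
    forall z, Cmod z < r -> C_cont b z /\ Cexp (b z) = h (node j z)).
  { induction j as [|j IH]; intros Hj.
    - destruct (polar_form (h 0) 0) as [t [_ Ht]].
      { apply Hne; rewrite Cmod_0; lra. }
      exists (fun _ => (ln (Cmod (h 0)), t)); intros z _; split; [apply C_cont_const|].
      rewrite Ht; f_equal; unfold node; simpl; unfold Rdiv; rewrite Rmult_0_l; ring.
    - destruct IH as [b IH]; [lia|].
      set (q := fun z => (h (node (S j) z) * / h (node j z))%C).
      assert (Hq : forall z, Cmod z < r -> 0 < fst (q z)).
      { intros z Hz.
        assert (Hj1 : Cmod (node j z) <= r) by (specialize (Hnode j z ltac:(lia)); lra).
        assert (Hd1 : Cmod (node (S j) z - node j z) < d).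
        { replace (node (S j) z - node j z)%C with (RtoC (/ INR n) * z)%C.
          2: { unfold node; rewrite S_INR.
               replace ((INR j + 1) / INR n) with (INR j / INR n + / INR n) by (field; lra).
               rewrite RtoC_plus; ring. }
          rewrite Cmod_RtoC_mult by (apply Rlt_le, Rinv_0_lt_compat, HnR).
          eapply Rle_lt_trans; [|exact Hn].
          unfold Rdiv; rewrite (Rmult_comm r).
          apply Rmult_le_compat_l; [apply Rlt_le, Rinv_0_lt_compat, HnR|lra]. }
        assert (Hu1 := Hu (node j z) (node (S j) z) ltac:(rewrite H0; exact Hj1) Hd1).
        assert (HM1 := HM (node j z) ltac:(rewrite H0; exact Hj1)).
        assert (Hq1 : Cmod (q z - 1) < 1).
        { replace (q z - 1)%C
            with ((h (node (S j) z) - h (node j z)) * / h (node j z))%C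
            by (unfold q; field; apply Hne, Hj1).
          rewrite Cmod_mult.
          assert (Hp : 0 < Cmod (/ h (node j z))).
          { rewrite Cmod_inv by (apply Hne, Hj1).
            apply Rinv_0_lt_compat, Cmod_gt_0, Hne, Hj1. }
          apply Rlt_le_trans with (/ M * Cmod (/ h (node j z))).
          - apply Rmult_lt_compat_r; assumption.
          - replace 1 with (/ M * M) by (field; lra).
            apply Rmult_le_compat_l; [apply Rlt_le, Rinv_0_lt_compat, HM0|exact HM1]. }
        pose proof (Rle_lt_trans _ _ _ (Rabs_fst_Cmod (q z - 1)) Hq1) as H1.
        change (fst (q z - 1)%C) with (fst (q z) + - (1)) in H1.
        apply Rabs_def2 in H1; lra. }
      exists (fun z => b z + Log (q z))%C; intros z Hz.
      assert (Hj1 : Cmod (node j z) <= r) by (specialize (Hnode j z ltac:(lia)); lra).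
      assert (Hj2 : Cmod (node (S j) z) <= r)
        by (specialize (Hnode (S j) z ltac:(lia)); lra).
      destruct (IH z Hz) as [IH1 IH2]; split.
      + apply C_cont_plus; [exact IH1|].
        apply C_cont_comp; [|apply C_cont_Log, Hq, Hz].
        destruct (Hh _ Hj1) as [l1 Hl1]; destruct (Hh _ Hj2) as [l2 Hl2].
        assert (Hn1 : forall i, C_diff (node i) z (RtoC (INR i / INR n) * 1)%C)
          by (intros i; apply C_diff_mult_const, C_diff_id).
        eapply C_diff_cont.
        apply (C_diff_mult (fun w => h (node (S j) w)) (fun w => / h (node j w))%C).
        * apply (C_diff_comp h (node (S j))); [apply Hn1|exact Hl2].
        * apply (C_diff_inv (fun w => h (node j w))); [apply Hne, Hj1|].
          apply (C_diff_comp h (node j)); [apply Hn1|exact Hl1].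
      + rewrite Cexp_plus, IH2, Cexp_Log by (apply Hq, Hz).
        unfold q; field; apply Hne, Hj1. }
  destruct (Hb n (le_n n)) as [b Hbn].
  assert (Hnn : forall z, node n z = z).
  { intros z; unfold node; rewrite Rdiv_diag by lra; ring. }
  exists b; intros z Hz; destruct (Hbn z Hz) as [B1 B2].
  rewrite Hnn in B2; split; [exact B2|]; intros l Hl.
  apply (C_diff_logarithm b h z l (r - Cmod z)); [lra| |exact B1|exact Hl].
  intros w Hw; pose proof (Cmod_le_add w z).
  destruct (Hbn w) as [_ B3]; [lra|]; rewrite Hnn in B3; exact B3.
Qed.

(** * A covering theorem *)

(** The function [phi] adapts the mean value theorem to the derivative bound at hand: the identity
    for a plain bound, [ln] for a bound by the real part itself, [arcsinh] for the weight
    [sqrt (u^2 + 1)]. *)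
Lemma path_mvt (G dG : C -> C) (phi dphi : R -> R) (a b : C) :
  (forall t, 0 <= t <= 1 -> C_diff G (a + RtoC t * b)%C (dG (a + RtoC t * b)%C)) ->
  (forall t, 0 <= t <= 1 -> derivable_pt_lim phi (fst (G (a + RtoC t * b)%C))
     (dphi (fst (G (a + RtoC t * b)%C)))) ->
  exists t, 0 <= t <= 1 /\ phi (fst (G (a + b)%C)) - phi (fst (G a))
    = dphi (fst (G (a + RtoC t * b)%C)) * fst (dG (a + RtoC t * b) * b)%C.
Proof.
  intros HG Hphi.
  assert (Hd : forall t, 0 <= t <= 1 ->
    derivable_pt_lim (fun s => phi (fst (G (a + RtoC s * b)%C))) t
      (dphi (fst (G (a + RtoC t * b)%C)) * fst (dG (a + RtoC t * b) * b)%C)).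
  { intros t Ht.
    apply (derivable_pt_lim_comp (fun s => fst (G (a + RtoC s * b)%C)) phi).
    - apply Re_path_derivable, HG, Ht.
    - apply Hphi, Ht. }
  destruct (MVT_gen (fun s => phi (fst (G (a + RtoC s * b)%C))) 0 1
    (fun t => dphi (fst (G (a + RtoC t * b)%C)) * fst (dG (a + RtoC t * b) * b)%C))
    as [t [Ht E]].
  - intros t Ht; rewrite Rmin_left, Rmax_right in Ht by lra.
    apply is_derive_Reals, Hd; lra.
  - intros t Ht; rewrite Rmin_left, Rmax_right in Ht by lra.
    apply derivable_continuous_pt; eexists; apply Hd, Ht.
  - rewrite Rmin_left, Rmax_right in Ht by lra.
    exists t; split; [exact Ht|].
    replace (a + RtoC 1 * b)%C with (a + b)%C in E by ring.
    replace (a + RtoC 0 * b)%C with a in E by ring.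
    lra.
Qed.

Lemma segment_in_disk (a b z0 : C) (r t : R) : 0 <= t <= 1 ->
  Cmod (a - z0) < r -> Cmod (a + b - z0) < r -> Cmod (a + RtoC t * b - z0) < r.
Proof.
  intros Ht Ha Hb.
  replace (a + RtoC t * b - z0)%C
    with (RtoC (1 - t) * (a - z0) + RtoC t * (a + b - z0))%C
    by (rewrite RtoC_minus; ring).
  eapply Rle_lt_trans; [apply Cmod_triangle|].
  rewrite !Cmod_RtoC_mult by lra.
  destruct (Req_dec t 0) as [->|H0]; [lra|].
  assert (t * Cmod (a + b - z0) < t * r) by (apply Rmult_lt_compat_l; lra).
  assert ((1 - t) * Cmod (a - z0) <= (1 - t) * r) by (apply Rmult_le_compat_l; lra).
  lra.
Qed.

Lemma mean_value_inequality (G dG : C -> C) (a b : C) (K : R) :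
  (forall t, 0 <= t <= 1 -> C_diff G (a + RtoC t * b)%C (dG (a + RtoC t * b)%C)
     /\ Cmod (dG (a + RtoC t * b)%C) <= K) ->
  Cmod (G (a + b) - G a)%C <= K * Cmod b.
Proof.
  intros HG.
  destruct (rotate_to_real (G (a + b) - G a)%C) as [c [Hc1 Hc2]].
  destruct (path_mvt (fun z => c * G z)%C (fun z => c * dG z)%C (fun x => x) (fun _ => 1) a b)
    as [t [Ht E]].
  - intros t Ht; apply C_diff_mult_const, HG, Ht.
  - intros; apply derivable_pt_lim_id.
  - replace (fst (c * G (a + b))%C - fst (c * G a)%C)
      with (fst (c * (G (a + b) - G a))%C) in E by (simpl; ring).
    rewrite Hc2, Rmult_1_l in E; simpl fst at 1 in E.
    rewrite E; eapply Rle_trans; [apply Rle_abs|].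
    eapply Rle_trans; [apply Rabs_fst_Cmod|].
    rewrite !Cmod_mult, Hc1, Rmult_1_l.
    apply Rmult_le_compat_r; [apply Cmod_ge_0|apply HG, Ht].
Qed.

Lemma sqrt_sqr_plus_1 (u : R) : Rabs u <= sqrt (u ^ 2 + 1) /\ 1 <= sqrt (u ^ 2 + 1).
Proof.
  split.
  - rewrite <- sqrt_Rsqr_abs; apply sqrt_le_1_alt; unfold Rsqr; lra.
  - rewrite <- sqrt_1 at 1; apply sqrt_le_1_alt; nra.
Qed.

Lemma sinh_opp (x : R) : sinh (- x) = - sinh x.
Proof. unfold sinh; rewrite Ropp_involutive; lra. Qed.

Lemma arcsinh_bound (u k : R) : Rabs (arcsinh u) <= k -> Rabs u <= sinh k.
Proof.
  intros H; apply Rabs_le_between in H.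
  assert (Hm : forall x y, x <= y -> sinh x <= sinh y).
  { intros x y [Hxy| ->]; [apply Rlt_le, sinh_lt, Hxy|lra]. }
  pose proof (Hm _ _ (proj1 H)) as H1; pose proof (Hm _ _ (proj2 H)) as H2.
  rewrite sinh_opp in H1; rewrite sinh_arcsinh in H1, H2.
  apply Rabs_le; lra.
Qed.

(** Without a zero the real part has constant sign, and [half_plane_derivative] bounds the
    derivative at 0 by [2 |u| / r <= |u|], where [u] is the real part of [G 0]; the normalisation
    [sqrt (u^2 + 1)] is larger. *)
Lemma real_part_zero (G dG : C -> C) (r : R) : 2 <= r ->
  (forall z, Cmod z <= r -> C_diff G z (dG z)) ->
  Cmod (dG 0) = sqrt (fst (G 0) ^ 2 + 1) ->
  exists p, Cmod p <= r /\ fst (G p) = 0.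
Proof.
  intros Hr HG H0.
  destruct (classic (exists p, Cmod p <= r /\ fst (G p) = 0)) as [H|Hno]; [exact H|exfalso].
  assert (Hz0 : forall z : C, Cmod (z - 0) = Cmod z) by (intros z; f_equal; ring).
  destruct (sqrt_sqr_plus_1 (fst (G 0))) as [W1 W2].
  assert (Hsign : forall (H dH : C -> C), (forall z, Cmod z <= r -> C_diff H z (dH z)) ->
    (forall z, Cmod z <= r -> fst (H z) <> 0) -> 0 < fst (H 0) ->
    Cmod (dH 0) <= Rabs (fst (H 0))).
  { intros H dH Hd Hnz Hpos.
    assert (Hall : forall z, Cmod z <= r -> 0 < fst (H z)).
    { intros z Hz; destruct (Rle_dec (fst (H z)) 0) as [Hneg|]; [|lra].
      assert (Hneg' : fst (H z) < 0) by (specialize (Hnz z Hz); lra).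
      assert (Ht : forall t, 0 <= t <= 1 -> Cmod (0 + RtoC t * z)%C <= r).
      { intros t Ht; rewrite Cplus_0_l, Cmod_RtoC_mult by lra.
        pose proof (Cmod_ge_0 z); nra. }
      destruct (Ranalysis5.IVT_interv (fun t => - fst (H (0 + RtoC t * z)%C)) 0 1) as [t [Ht1 Ht2]].
      - intros t Ht'; apply continuity_pt_opp, derivable_continuous_pt.
        eexists; apply Re_path_derivable, Hd, Ht, Ht'.
      - lra.
      - replace (0 + RtoC 0 * z)%C with (RtoC 0) by ring; lra.
      - replace (0 + RtoC 1 * z)%C with z by ring; lra.
      - exfalso; apply (Hnz _ (Ht t Ht1)); lra. }
    assert (Hh : Cmod (dH 0) <= 2 * fst (H 0) / r).
    { apply (half_plane_derivative H 0 (dH 0) r); try lra.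
      - intros z Hz; rewrite Hz0 in Hz; exists (dH z); apply Hd, Hz.
      - apply Hd; rewrite Cmod_0; lra.
      - intros z Hz; rewrite Hz0 in Hz; apply Hall, Hz. }
    eapply Rle_trans; [exact Hh|]; rewrite Rabs_pos_eq by lra.
    apply Rmult_le_reg_r with r; [lra|].
    unfold Rdiv; rewrite Rmult_assoc, Rinv_l by lra; nra. }
  assert (Hbig : Rabs (fst (G 0)) < sqrt (fst (G 0) ^ 2 + 1)).
  { rewrite <- sqrt_Rsqr_abs; apply sqrt_lt_1_alt; unfold Rsqr; split; [nra|lra]. }
  destruct (Rtotal_order (fst (G 0)) 0) as [Hlt|[Heq|Hgt]].
  - specialize (Hsign (fun z => - (1) * G z)%C (fun z => - (1) * dG z)%C).
    assert (K : Cmod (- (1) * dG 0) <= Rabs (fst (- (1) * G 0)%C)).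
    { apply Hsign.
      - intros z Hz; apply C_diff_mult_const, HG, Hz.
      - intros z Hz K; apply Hno; exists z; split; [exact Hz|].
        simpl in K; lra.
      - simpl; lra. }
    rewrite Cmod_mult, Cmod_m1, Rmult_1_l, H0 in K.
    replace (fst (- (1) * G 0)%C) with (- fst (G 0)) in K by (simpl; ring).
    rewrite Rabs_Ropp in K; lra.
  - apply Hno; exists (RtoC 0); rewrite Cmod_0; split; [lra|exact Heq].
  - specialize (Hsign G dG HG); rewrite H0 in Hsign.
    apply (Rlt_not_le _ _ Hbig), Hsign; [|exact Hgt].
    intros z Hz K; apply Hno; exists z; split; assumption.
Qed.

(* Bounds [|G z - G p| + 1] in [normalised_covering], where [|z - p| <= 17] and
   [|arcsinh (Re G)| <= 34]. *)
Definition covering_bound : R := 34 * sqrt (sinh 34 ^ 2 + 1) + 1.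

Lemma covering_bound_ge_1 : 1 <= covering_bound.
Proof.
  unfold covering_bound; destruct (sqrt_sqr_plus_1 (sinh 34)); lra.
Qed.

Lemma exp_2_le_9 : exp 2 <= 9.
Proof.
  replace 2 with (1 + 1) by ring; rewrite exp_plus.
  pose proof exp_le_3; pose proof (exp_pos 1); nra.
Qed.

(* A nonvanishing [h] bounded by [B] that is tiny at [p] is tiny, with tiny
   derivative, on a neighbourhood: Harnack's inequality for the positive
   harmonic function [ln B - ln |h|]. *)
Lemma nonvanishing_small_derivative (h dh : C -> C) (p : C) (B : R) :
  1 <= B -> Cmod p <= 5 ->
  (forall z, Cmod z < 12 -> C_diff h z (dh z)) ->
  (forall z, Cmod z < 12 -> h z <> RtoC 0) ->
  (forall z, Cmod z < 12 -> Cmod (h z) < B) ->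
  Cmod (h p) < exp (- (12 * B)) -> Cmod (dh 0) < 1.
Proof.
  intros HB Hp Hd Hne Hbd Hsmall.
  (* The radius lies strictly between 12, where [h] is controlled, and 11 = 5 + 6, which contains
     the disks of radius 6 used in [Hder]. *)
  destruct (logarithm_on_disk h (23 / 2)) as [b Hb]; [lra| | |].
  { intros z Hz; exists (dh z); apply Hd; lra. }
  { intros z Hz; apply Hne; lra. }
  set (U := fun z => (RtoC (ln B) - b z)%C).
  assert (HU : forall z, Cmod z < 23 / 2 -> exp (- fst (U z)) * B = Cmod (h z)).
  { intros z Hz; destruct (Hb z Hz) as [E _]; rewrite <- E, Cmod_Cexp.
    unfold U; simpl.
    replace (- (ln B + - fst (b z))) with (fst (b z) - ln B) by ring.
    unfold Rminus; rewrite exp_plus, exp_Ropp, exp_ln by lra; field; lra. }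
  assert (HUpos : forall z, Cmod z < 23 / 2 -> 0 < fst (U z)).
  { intros z Hz; specialize (HU z Hz); specialize (Hbd z ltac:(lra)).
    destruct (Rle_dec (fst (U z)) 0) as [K|]; [|lra].
    pose proof (exp_ineq1_le (- fst (U z))); nra. }
  assert (HUd : forall z, Cmod z < 23 / 2 -> C_diff U z (0 - dh z / h z)%C).
  { intros z Hz; apply C_diff_minus; [apply C_diff_const|].
    apply Hb; [exact Hz|apply Hd; lra]. }
  assert (Hder : forall z, Cmod z <= 5 -> Cmod (0 - dh z / h z) <= fst (U z) / 3).
  { intros z Hz.
    assert (Hin : forall w, Cmod (w - z) <= 6 -> Cmod w < 23 / 2).
    { intros w Hw; pose proof (Cmod_le_add w z); lra. }
    replace (fst (U z) / 3) with (2 * fst (U z) / 6) by field.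
    apply (half_plane_derivative U z _ 6); [lra| | |].
    - intros w Hw; eexists; apply HUd, Hin, Hw.
    - apply HUd; lra.
    - intros w Hw; apply HUpos, Hin, Hw. }
  assert (HUp : 12 * B < fst (U p)).
  { specialize (HU p ltac:(lra)).
    apply Ropp_lt_cancel, exp_lt_inv.
    apply Rle_lt_trans with (Cmod (h p)); [|exact Hsmall].
    rewrite <- HU; pose proof (exp_pos (- fst (U p))); nra. }
  assert (Hseg : forall t, 0 <= t <= 1 -> Cmod (p + RtoC t * - p)%C <= 5).
  { intros t Ht; replace (p + RtoC t * - p)%C with (RtoC (1 - t) * p)%C
      by (rewrite RtoC_minus; ring).
    rewrite Cmod_RtoC_mult by lra; pose proof (Cmod_ge_0 p); nra. }
  destruct (path_mvt U (fun z => 0 - dh z / h z)%C ln Rinv p (- p)%C) as [t [Ht E]].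
  { intros t Ht; apply HUd; specialize (Hseg t Ht); lra. }
  { intros t Ht; apply derivable_pt_lim_ln, HUpos; specialize (Hseg t Ht); lra. }
  replace (p + - p)%C with (RtoC 0) in E by ring.
  set (q := (p + RtoC t * - p)%C) in *.
  assert (Hq : Cmod q <= 5) by (apply Hseg, Ht).
  assert (HUq : 0 < fst (U q)) by (apply HUpos; lra).
  assert (HU0 : 0 < fst (U 0)) by (apply HUpos; rewrite Cmod_0; lra).
  (* The logarithmic derivative of the real part of [U] is at most 1/3 along a segment of length at
     most 5, so its logarithm drops by at most 5/3, rounded up to 2. *)
  assert (HE : - 2 <= ln (fst (U 0)) - ln (fst (U p))).
  { rewrite E.
    assert (K : Rabs (fst ((0 - dh q / h q) * - p)%C) <= fst (U q) / 3 * 5).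
    { eapply Rle_trans; [apply Rabs_fst_Cmod|].
      rewrite Cmod_mult, Cmod_opp.
      apply Rmult_le_compat; try apply Cmod_ge_0; [apply Hder, Hq|exact Hp]. }
    apply Rabs_le_between in K.
    assert (K2 : 0 < / fst (U q)) by (apply Rinv_0_lt_compat, HUq).
    assert (K3 : / fst (U q) * fst (U q) = 1) by (field; lra).
    apply Rle_trans with (/ fst (U q) * - (fst (U q) / 3 * 5)).
    - replace (/ fst (U q) * - (fst (U q) / 3 * 5))
        with (- (/ fst (U q) * fst (U q)) * (5 / 3)) by (field; lra).
      rewrite K3; lra.
    - apply Rmult_le_compat_l; lra. }
  assert (HU0big : 4 / 3 * B < fst (U 0)).
  { assert (K : fst (U p) <= 9 * fst (U 0)).
    { rewrite <- (exp_ln (fst (U p))) by lra.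
      apply Rle_trans with (exp (2 + ln (fst (U 0)))).
      - destruct (Req_dec (ln (fst (U p))) (2 + ln (fst (U 0)))) as [->|Hn]; [lra|].
        apply Rlt_le, exp_increasing; lra.
      - rewrite exp_plus, exp_ln by lra; pose proof exp_2_le_9; nra. }
    lra. }
  specialize (Hder 0 ltac:(rewrite Cmod_0; lra)).
  specialize (HU 0 ltac:(rewrite Cmod_0; lra)).
  assert (Hh0 : h 0 <> RtoC 0) by (apply Hne; rewrite Cmod_0; lra).
  replace (dh 0) with (- ((0 - dh 0 / h 0) * h 0))%C by (field; exact Hh0).
  rewrite Cmod_opp, Cmod_mult, <- HU.
  set (u := fst (U 0)) in *.
  apply Rle_lt_trans with (u / 3 * (exp (- u) * B)).
  { apply Rmult_le_compat_r; [|exact Hder].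
    pose proof (exp_pos (- u)); nra. }
  (* As [B < 3/4 * u], the bound [u / 3 * exp (- u) * B] is at most [u^2 / 4 * exp (- u)], which
     this inequality makes smaller than 1. *)
  assert (Hexp : (u / 2) * (u / 2) < exp u).
  { replace u with (u / 2 + u / 2) at 3 by field; rewrite exp_plus.
    pose proof (exp_ineq1_le (u / 2)); nra. }
  assert (Hinv : exp (- u) * exp u = 1) by (rewrite <- exp_plus, Rplus_opp_l; apply exp_0).
  pose proof (exp_pos (- u)) as Hpos.
  assert (H1 : exp (- u) * ((u / 2) * (u / 2)) < 1) by (rewrite <- Hinv; nra).
  assert (H2 : u * B <= 3 / 4 * u * u) by nra.
  replace (u / 3 * (exp (- u) * B)) with (exp (- u) * (u * B / 3)) by field.
  eapply Rle_lt_trans; [|exact H1].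
  apply Rmult_le_compat_l; lra.
Qed.

(** If a value [v] close to [G p] were missed, [G - v] would be nonvanishing, bounded by
    [covering_bound] and tiny at [p], so its derivative at 0 would have modulus below 1; the
    normalisation makes that modulus at least 1. *)
Lemma normalised_covering (G dG : C -> C) :
  (forall z, Cmod z < 12 -> C_diff G z (dG z)) ->
  (forall z, Cmod z < 12 -> Cmod (dG z) <= 2 * sqrt (fst (G z) ^ 2 + 1)) ->
  Cmod (dG 0) = sqrt (fst (G 0) ^ 2 + 1) ->
  exists p, Cmod p < 12 /\ fst (G p) = 0 /\
    forall v, Cmod (v - G p) < exp (- (12 * covering_bound)) ->
    exists z, Cmod z < 12 /\ G z = v.
Proof.
  intros HG Hbd H0.
  assert (Hz0 : forall z : C, Cmod (z - 0) = Cmod z) by (intros z; f_equal; ring).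
  destruct (real_part_zero G dG 5) as [p [Hp Hp0]]; [lra| |exact H0|].
  { intros z Hz; apply HG; lra. }
  exists p; split; [lra|split; [exact Hp0|]]; intros v Hv.
  destruct (classic (exists z, Cmod z < 12 /\ G z = v)) as [H|Hno]; [exact H|exfalso].
  set (A := sqrt (sinh 34 ^ 2 + 1)).
  assert (Hseg : forall z t, Cmod z < 12 -> 0 <= t <= 1 ->
    Cmod (p + RtoC t * (z - p))%C < 12).
  { intros z t Hz Ht; rewrite <- Hz0; apply segment_in_disk; [exact Ht| |]; rewrite Hz0.
    - lra.
    - replace (p + (z - p))%C with z by ring; exact Hz. }
  assert (Hlen : forall z, Cmod z < 12 -> Cmod (z - p) <= 17).
  { intros z Hz; pose proof (Cmod_triangle z (- p)) as K; rewrite Cmod_opp in K.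
    unfold Cminus; lra. }
  (* By the derivative bound [arcsinh] of the real part is 2-Lipschitz; it is 0 at [p], and
     [|z - p| <= 12 + 5], whence 34. *)
  assert (HdA : forall z, Cmod z < 12 -> Cmod (dG z) <= 2 * A).
  { intros z Hz; eapply Rle_trans; [apply Hbd, Hz|].
    apply Rmult_le_compat_l; [lra|apply sqrt_le_1_alt].
    apply Rplus_le_compat_r.
    assert (K : Rabs (fst (G z)) <= sinh 34).
    { apply arcsinh_bound.
      destruct (path_mvt G dG arcsinh (fun x => / sqrt (x ^ 2 + 1)) p (z - p)%C)
        as [t [Ht E]].
      - intros t Ht; apply HG, Hseg; assumption.
      - intros t Ht; apply derivable_pt_lim_arcsinh.
      - replace (p + (z - p))%C with z in E by ring.
        rewrite Hp0, arcsinh_0, Rminus_0_r in E; rewrite E, Rabs_mult.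
        set (q := (p + RtoC t * (z - p))%C) in *.
        destruct (sqrt_sqr_plus_1 (fst (G q))) as [_ W].
        rewrite Rabs_inv, Rabs_pos_eq by lra.
        assert (K : Rabs (fst (dG q * (z - p))%C) <= 2 * sqrt (fst (G q) ^ 2 + 1) * 17).
        { eapply Rle_trans; [apply Rabs_fst_Cmod|]; rewrite Cmod_mult.
          apply Rmult_le_compat; try apply Cmod_ge_0; [|apply Hlen, Hz].
          apply Hbd, Hseg; assumption. }
        apply Rle_trans with (/ sqrt (fst (G q) ^ 2 + 1) * (2 * sqrt (fst (G q) ^ 2 + 1) * 17)).
        + apply Rmult_le_compat_l; [apply Rlt_le, Rinv_0_lt_compat; lra|exact K].
        + apply Req_le; field; lra. }
    apply Rabs_le_between in K; nra. }
  assert (Hdist : forall z, Cmod z < 12 -> Cmod (G z - G p) <= 34 * A).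
  { intros z Hz.
    pose proof (mean_value_inequality G dG p (z - p)%C (2 * A)) as K.
    replace (p + (z - p))%C with z in K by ring.
    eapply Rle_trans; [apply K|].
    - intros t Ht; split; [apply HG|apply HdA]; apply Hseg; assumption.
    - assert (0 <= A) by apply sqrt_pos.
      specialize (Hlen z Hz); nra. }
  assert (Hlt : exp (- (12 * covering_bound)) < 1).
  { rewrite <- exp_0; apply exp_increasing; pose proof covering_bound_ge_1; lra. }
  assert (K : Cmod (dG 0) < 1).
  { pose proof (nonvanishing_small_derivative (fun z => G z - v)%C
      (fun z => dG z - 0)%C p covering_bound covering_bound_ge_1 Hp) as K.
    replace (dG 0) with (dG 0 - 0)%C by ring; apply K.
    - intros z Hz; apply C_diff_minus; [apply HG, Hz|apply C_diff_const].
    - intros z Hz E; apply Hno; exists z; split; [exact Hz|].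
      replace (G z) with ((G z - v) + v)%C by ring; rewrite E; ring.
    - intros z Hz; eapply Rle_lt_trans; [apply (Cmod_minus_triangle _ (G p))|].
      specialize (Hdist z Hz); rewrite (Cmod_minus_sym (G p) v).
      unfold covering_bound; fold A; lra.
    - rewrite Cmod_minus_sym; exact Hv. }
  destruct (sqrt_sqr_plus_1 (fst (G 0))); lra.
Qed.

(* The rescaling centre almost maximises
   [|G'| (16 - |w - w0|) / sqrt ((Re G)^2 + 1)]. *)
Lemma covering_rescaled (G dG : C -> C) (w0 w1 : C) :
  (forall w, Cmod (w - w0) < 18 -> C_diff G w (dG w)) ->
  Cmod (w1 - w0) <= 8 -> fst (G w0) <= 0 -> sinh 64 <= fst (G w1) ->
  exists p, Cmod (p - w0) < 16 /\ fst (G p) = 0 /\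
    forall v, Cmod (v - G p) < exp (- (12 * covering_bound)) ->
    exists w, Cmod (w - w0) < 16 /\ G w = v.
Proof.
  intros HG Hw1 Hu0 Hu1.
  set (wt := fun w => sqrt (fst (G w) ^ 2 + 1)).
  assert (Hwt : forall w, 1 <= wt w) by (intros w; apply sqrt_sqr_plus_1).
  set (phi := fun w => Cmod (dG w) / wt w * (16 - Cmod (w - w0))).
  (* Only to make the supremum of [phi] finite: Cauchy estimates on circles of radius 1 bound [dG]
     on the disk of radius 16. *)
  destruct (closed_disk_bounded G w0 17) as [M HM]; [lra| |].
  { intros w Hw; apply (C_diff_cont _ _ (dG w)), HG; lra. }
  assert (Hder : forall w, Cmod (w - w0) < 16 -> Cmod (dG w) <= 2 * M).
  { intros w Hw; replace (2 * M) with (2 * M / 1) by field.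
    assert (Hin : forall z, Cmod (z - w) <= 1 -> Cmod (z - w0) <= 17).
    { intros z Hz; pose proof (Cmod_minus_triangle z w w0); lra. }
    apply (cauchy_estimate G w (dG w) 1); [lra| | |].
    - intros z Hz; exists (dG z); apply HG; specialize (Hin z Hz); lra.
    - apply HG; lra.
    - intros z Hz; eapply Rle_trans; [apply Cmod_triangle|rewrite Cmod_opp].
      assert (K1 := HM z (Hin z ltac:(lra))); assert (K2 := HM w ltac:(lra)); lra. }
  assert (Hratio : forall w, Cmod (dG w) / wt w * wt w = Cmod (dG w)).
  { intros w; field; specialize (Hwt w); lra. }
  assert (Hratio0 : forall w, 0 <= Cmod (dG w) / wt w).
  { intros w; apply Rmult_le_pos; [apply Cmod_ge_0|].
    apply Rlt_le, Rinv_0_lt_compat; specialize (Hwt w); lra. }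
  destruct (completeness (fun x => exists w, Cmod (w - w0) < 16 /\ x = phi w)) as [S [HS1 HS2]].
  { exists (2 * M * 16); intros x [w [Hw ->]].
    specialize (Hder w Hw); specialize (Hratio w); specialize (Hratio0 w).
    specialize (Hwt w); pose proof (Cmod_ge_0 (w - w0)).
    unfold phi; apply Rmult_le_compat; nra. }
  { exists (phi w0), w0; split; [|reflexivity].
    replace (w0 - w0)%C with (RtoC 0) by ring; rewrite Cmod_0; lra. }
  (* On the segment from [w0] to [w1], of length at most 8, [arcsinh] of the real part rises by 64,
     so the weighted derivative is at least 8 somewhere, and there [16 - |w - w0| >= 8]. *)
  assert (HS64 : 64 <= S).
  { assert (Hseg : forall t, 0 <= t <= 1 -> Cmod (w0 + RtoC t * (w1 - w0) - w0)%C <= 8).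
    { intros t Ht.
      replace (w0 + RtoC t * (w1 - w0) - w0)%C with (RtoC t * (w1 - w0))%C by ring.
      rewrite Cmod_RtoC_mult by lra; pose proof (Cmod_ge_0 (w1 - w0)); nra. }
    destruct (path_mvt G dG arcsinh (fun x => / sqrt (x ^ 2 + 1)) w0 (w1 - w0)%C)
      as [t [Ht E]].
    - intros t Ht; apply HG; specialize (Hseg t Ht); lra.
    - intros t Ht; apply derivable_pt_lim_arcsinh.
    - replace (w0 + (w1 - w0))%C with w1 in E by ring.
      specialize (Hseg t Ht).
      set (q := (w0 + RtoC t * (w1 - w0))%C) in *.
      apply Rle_trans with (phi q).
      + assert (A0 : arcsinh (fst (G w0)) <= 0).
        { rewrite <- arcsinh_0; apply arcsinh_le, Hu0. }
        assert (A1 : 64 <= arcsinh (fst (G w1))).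
        { rewrite <- (arcsinh_sinh 64); apply arcsinh_le, Hu1. }
        assert (K : Rabs (fst (dG q * (w1 - w0))%C) <= Cmod (dG q) * 8).
        { eapply Rle_trans; [apply Rabs_fst_Cmod|]; rewrite Cmod_mult.
          apply Rmult_le_compat_l; [apply Cmod_ge_0|exact Hw1]. }
        apply Rabs_le_between in K.
        apply Rle_trans with (Cmod (dG q) / wt q * 8).
        * fold (wt q) in E.
          assert (Hi : 0 < / wt q) by (apply Rinv_0_lt_compat; specialize (Hwt q); lra).
          unfold Rdiv; nra.
        * unfold phi; apply Rmult_le_compat_l; [apply Hratio0|lra].
      + apply HS1; exists q; split; [lra|reflexivity]. }
  assert (Hstar : exists w, Cmod (w - w0) < 16 /\ 3 / 4 * S < phi w).
  { apply NNPP; intros Hno.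
    assert (K : S <= 3 / 4 * S); [|lra].
    apply HS2; intros x [w [Hw ->]].
    destruct (Rle_dec (phi w) (3 / 4 * S)) as [K|K]; [exact K|].
    exfalso; apply Hno; exists w; split; [exact Hw|lra]. }
  destruct Hstar as [ws [Hws Hphi]].
  set (d := 16 - Cmod (ws - w0)).
  assert (Hd : 0 < d) by (unfold d; lra).
  set (q := Cmod (dG ws) / wt ws).
  assert (Hqd : phi ws = q * d) by reflexivity.
  assert (Hq : 0 < q).
  { destruct (Rle_lt_or_eq_dec 0 q (Hratio0 ws)) as [K|K]; [exact K|].
    exfalso; rewrite <- K in Hqd; lra. }
  (* Because [q * d > 3/4 * 64 = 48], the rescaled disk of radius 12 moves points by less than
     [d / 4]. *)
  assert (Hcoord : forall z, Cmod z < 12 -> Cmod (RtoC (/ q) * z) < d / 4).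
  { intros z Hz; rewrite Cmod_RtoC_mult by (apply Rlt_le, Rinv_0_lt_compat, Hq).
    apply Rmult_lt_reg_l with q; [exact Hq|].
    rewrite <- Rmult_assoc, Rinv_r, Rmult_1_l by lra; lra. }
  assert (Hin : forall z, Cmod z < 12 ->
    Cmod (ws + RtoC (/ q) * z - w0)%C < 16 - 3 / 4 * d).
  { intros z Hz; specialize (Hcoord z Hz).
    replace (ws + RtoC (/ q) * z - w0)%C with ((ws - w0) + RtoC (/ q) * z)%C by ring.
    eapply Rle_lt_trans; [apply Cmod_triangle|unfold d in *; lra]. }
  assert (Hws0 : (ws + RtoC (/ q) * 0)%C = ws) by ring.
  assert (HiqR : 0 < / q) by (apply Rinv_0_lt_compat, Hq).
  destruct (normalised_covering (fun z => G (ws + RtoC (/ q) * z)%C)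
    (fun z => dG (ws + RtoC (/ q) * z) * RtoC (/ q))%C) as [p (Hp & Hp0 & Hcov)].
  - intros z Hz.
    apply (C_diff_comp G (fun z => ws + RtoC (/ q) * z)%C); [apply C_diff_affine|].
    apply HG; specialize (Hin z Hz); lra.
  - intros z Hz; specialize (Hin z Hz); set (w := (ws + RtoC (/ q) * z)%C) in *.
    fold (wt w); rewrite Cmod_mult, Cmod_R, Rabs_pos_eq by lra.
    assert (K : phi w <= S) by (apply HS1; exists w; split; [lra|reflexivity]).
    (* Staying within [d / 4] of [ws] costs a factor 4/3, near-maximality another 4/3, and 16/9 is
       below the factor 2 allowed by [normalised_covering]. *)
    assert (K2 : Cmod (dG w) / wt w * (3 / 4 * d) <= 4 / 3 * (q * d)).
    { apply Rle_trans with (phi w); [|lra].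
      unfold phi; apply Rmult_le_compat_l; [apply Hratio0|lra]. }
    assert (K3 : Cmod (dG w) / wt w <= 2 * q) by nra.
    rewrite <- (Hratio w).
    replace (2 * wt w) with (2 * q * wt w * / q) by (field; lra).
    apply Rmult_le_compat_r; [lra|].
    apply Rmult_le_compat_r; [specialize (Hwt w); lra|exact K3].
  - rewrite Hws0; fold (wt ws); rewrite Cmod_mult, Cmod_R, Rabs_pos_eq by lra.
    rewrite <- (Hratio ws); fold q; field; lra.
  - exists (ws + RtoC (/ q) * p)%C; split; [specialize (Hin p Hp); lra|].
    split; [exact Hp0|]; intros v Hv.
    destruct (Hcov v Hv) as [z [Hz E]].
    exists (ws + RtoC (/ q) * z)%C; split; [specialize (Hin z Hz); lra|exact E].
Qed.

(** Multiplying [F - a] by [k = c / N] turns the absolute covering radius [c] into [N]; the price is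
    the rise [sinh 64 / k]. The quantifier order matters: [L] depends on [N] alone, so [F] can be
    chosen afterwards. *)
Lemma covering_theorem (N : R) : 0 < N -> exists L, forall (F dF : C -> C) (w0 w1 : C) (a : R),
  (forall w, Cmod (w - w0) < 18 -> C_diff F w (dF w)) ->
  Cmod (w1 - w0) <= 8 -> fst (F w0) <= a -> a + L <= fst (F w1) ->
  exists p, Cmod (p - w0) < 16 /\ fst (F p) = a /\
    forall v, Cmod (v - F p) < N -> exists w, Cmod (w - w0) < 16 /\ F w = v.
Proof.
  intros HN.
  set (c := exp (- (12 * covering_bound))).
  assert (Hc : 0 < c) by apply exp_pos.
  set (k := c / N).
  assert (Hk : 0 < k) by (apply Rdiv_lt_0_compat; assumption).
  exists (sinh 64 / k); intros F dF w0 w1 a HF Hw Ha HL.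
  assert (Hfst : forall z, fst (RtoC k * (z - RtoC a))%C = k * (fst z - a)).
  { intros z; rewrite real_multiple; reflexivity. }
  destruct (covering_rescaled (fun w => RtoC k * (F w - RtoC a))%C
    (fun w => RtoC k * (dF w - 0))%C w0 w1) as [p (Hp & Hp0 & Hcov)].
  - intros w Hw'; apply C_diff_mult_const, C_diff_minus; [apply HF, Hw'|apply C_diff_const].
  - exact Hw.
  - rewrite Hfst; nra.
  - rewrite Hfst; apply (Rmult_le_compat_l k) in HL; [|lra].
    replace (k * (a + sinh 64 / k)) with (k * a + sinh 64) in HL by (field; lra); lra.
  - rewrite Hfst in Hp0.
    exists p; split; [exact Hp|]; split; [nra|]; intros v Hv.
    destruct (Hcov (RtoC k * (v - RtoC a))%C) as [w [Hw' E]].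
    + replace (RtoC k * (v - RtoC a) - RtoC k * (F p - RtoC a))%C
        with (RtoC k * (v - F p))%C by ring.
      rewrite Cmod_RtoC_mult by lra; fold c.
      replace c with (k * N) by (unfold k; field; lra).
      apply Rmult_lt_compat_l; assumption.
    + exists w; split; [exact Hw'|].
      assert (Hk0 : RtoC k <> RtoC 0) by (intros K; apply RtoC_inj in K; lra).
      replace (F w) with (/ RtoC k * (RtoC k * (F w - RtoC a)) + RtoC a)%C
        by (field; exact Hk0).
      rewrite E; field; exact Hk0.
Qed.

(** * Growth of entire functions *)

Lemma derivative_function (f : C -> C) :
  (forall z, exists l, C_diff f z l) -> exists df, forall z, C_diff f z (df z).
Proof.
  intros H.
  exists (fun z => proj1_sig (constructive_indefinite_description _ (H z))).
  intros z; apply proj2_sig.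
Qed.

Lemma linear_growth_affine (f df : C -> C) (K r0 : R) :
  (forall z, C_diff f z (df z)) ->
  (forall z, r0 <= Cmod z -> Cmod (f z) <= K * Cmod z) ->
  exists c0 c1 : C, forall z, f z = (c0 + c1 * z)%C.
Proof.
  intros Hf HK.
  assert (Hz0 : forall z : C, Cmod (z - 0) = Cmod z) by (intros z; f_equal; ring).
  destruct (closed_disk_bounded f 0 (Rmax 0 r0)) as [B0 HB0]; [apply Rmax_l| |].
  { intros z _; apply (C_diff_cont _ _ _ (Hf z)). }
  set (B := Rmax 0 B0); set (k := Rmax 0 K).
  assert (HB : 0 <= B /\ B0 <= B) by (split; [apply Rmax_l|apply Rmax_r]).
  assert (Hk : 0 <= k /\ K <= k) by (split; [apply Rmax_l|apply Rmax_r]).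
  assert (Hlin : forall z, Cmod (f z) <= k * Cmod z + B).
  { intros z; pose proof (Cmod_ge_0 z).
    destruct (Rle_dec r0 (Cmod z)) as [Hz|Hz].
    - specialize (HK z Hz); nra.
    - specialize (HB0 z); rewrite Hz0 in HB0; pose proof (Rmax_r 0 r0).
      specialize (HB0 ltac:(lra)); nra. }
  assert (Hd : forall z, Cmod (df z) <= k + 1).
  { intros z; pose proof (Cmod_ge_0 z).
    (* On this circle [|f w| + |f z|] is at most [k * r + 2 * (k * |z| + B)], and [r] dominates the
       last term. *)
    set (r := 2 * (k * Cmod z + B) + 1).
    assert (Hr : 1 <= r) by (unfold r; nra).
    replace (k + 1) with ((k * r + r) / r) by (field; lra).
    apply (cauchy_estimate f z (df z) r); [lra| |apply Hf|].
    - intros w _; exists (df w); apply Hf.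
    - intros w Hw.
      eapply Rle_trans; [apply Cmod_triangle|rewrite Cmod_opp].
      pose proof (Hlin w) as H1; pose proof (Hlin z) as H2.
      pose proof (Cmod_le_add w z) as H3; rewrite Hw in H3.
      unfold r in *; nra. }
  assert (Hconst : forall z, df z = df 0).
  { intros z; apply Cmod_minus_eq.
    destruct (Rle_dec (Cmod (df z - df 0)) 0) as [H|H]; [exact H|exfalso].
    pose proof (Cmod_ge_0 z) as Hz.
    set (m := Cmod (df z - df 0)) in *.
    set (M := 2 * ((k + 1) * Cmod z)).
    assert (HM : 0 <= M) by (unfold M; nra).
    (* With this radius the Cauchy bound is [m * M / (M + 1)], which is smaller than [m]. *)
    assert (Hr : 0 < (M + 1) / m) by (apply Rdiv_lt_0_compat; lra).
    assert (Hm : m <= M / ((M + 1) / m)).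
    { assert (Hg : forall w, C_diff (fun w => f (z + 1 * w) - f w)%C w
        (df (z + 1 * w) * 1 - df w)%C).
      { intros w; apply C_diff_minus; [|apply Hf].
        apply (C_diff_comp f (fun w => z + 1 * w)%C); [apply C_diff_affine|apply Hf]. }
      assert (Hgb : forall w, Cmod (f (z + 1 * w) - f w)%C <= (k + 1) * Cmod z).
      { intros w; replace (z + 1 * w)%C with (w + z)%C by ring.
        apply (mean_value_inequality f df); intros t _; split; [apply Hf|apply Hd]. }
      pose proof (cauchy_estimate (fun w => f (z + 1 * w) - f w)%C 0 _
        ((M + 1) / m) M Hr (fun w _ => ex_intro _ _ (Hg w)) (Hg 0)) as HC.
      replace (df (z + 1 * 0) * 1 - df 0)%C with (df z - df 0)%C in HC
        by (replace (z + 1 * 0)%C with z by ring; ring).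
      apply HC; intros w _.
      eapply Rle_trans; [apply Cmod_triangle|rewrite Cmod_opp].
      pose proof (Hgb w); pose proof (Hgb 0); unfold M; lra. }
    replace (M / ((M + 1) / m)) with (m * (M / (M + 1))) in Hm by (field; lra).
    assert (M / (M + 1) < 1).
    { apply Rmult_lt_reg_r with (M + 1); [lra|].
      unfold Rdiv; rewrite Rmult_assoc, Rinv_l by lra; lra. }
    nra. }
  exists (f 0), (df 0); intros z; apply Cmod_minus_eq.
  replace (f z - (f 0 + df 0 * z))%C
    with ((f (0 + z) - df 0 * (0 + z)) - (f 0 - df 0 * 0))%C
    by (replace (0 + z)%C with z by ring; ring).
  apply Rle_trans with (0 * Cmod z); [|lra].
  apply (mean_value_inequality (fun w => f w - df 0 * w)%C (fun w => df w - df 0 * 1)%C).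
  intros t _; split.
  - apply C_diff_minus; [apply Hf|apply C_diff_mult_const, C_diff_id].
  - rewrite Hconst; replace (df 0 - df 0 * 1)%C with (RtoC 0) by ring.
    rewrite Cmod_0; lra.
Qed.

(** Were [|f| > r] on the whole circle, the maximum principle for [1 / f] would give [|f 0| >= r].
    This provides the low end of the rise of [Re F]. *)
Lemma small_value_on_circle (f df : C -> C) (r : R) :
  (forall z, C_diff f z (df z)) -> (forall z, f z <> RtoC 0) -> Cmod (f 0) < r ->
  exists z, Cmod z = r /\ Cmod (f z) <= r.
Proof.
  intros Hf Hne Hr.
  assert (H0 : 0 < Cmod (f 0)) by (apply Cmod_gt_0, Hne).
  apply NNPP; intros Hno.
  assert (K : Cmod (/ f 0) <= / r).
  { assert (Hd : forall z, C_diff (fun w => / f w)%C z (- df z / (f z * f z))).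
    { intros z; apply C_diff_inv; [apply Hne|apply Hf]. }
    apply (maximum_principle (fun w => / f w)%C r); [lra| | |].
    - intros z _ _; eexists; apply Hd.
    - apply (C_diff_cont _ _ _ (Hd 0)).
    - intros z Hz; rewrite Cmod_inv by apply Hne.
      apply Rinv_le_contravar; [lra|].
      destruct (Rle_dec (Cmod (f z)) r) as [Hle|]; [|lra].
      exfalso; apply Hno; exists z; split; assumption. }
  rewrite Cmod_inv in K by apply Hne.
  apply Rinv_lt_contravar in Hr; [lra|nra].
Qed.

(** * Horseshoes *)

Lemma exp_le_inv (x y : R) : exp x <= exp y -> x <= y.
Proof.
  intros H; apply Rnot_lt_le; intros K; apply exp_increasing in K; lra.
Qed.

(* With [f = exp g], the covering theorem is applied to [w => g (exp w)]; the
   label of [z] is [k] when [Im g z] lies in the [k]-th of disjoint windows of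
   length [2 PI], each of which [exp] maps onto whole circles. *)
Lemma horseshoe (f : C -> C) (N : nat) :
  (forall z, exists l, C_diff f z l) -> (forall z, f z <> RtoC 0) ->
  (forall K r, exists z, r <= Cmod z /\ K * Cmod z < Cmod (f z)) ->
  exists (A : C -> Prop) (label : nat -> C -> Prop) (B delta : R),
    0 <= B /\ 0 < delta /\ (exists x, A x) /\ (forall x, A x -> Cmod x <= B) /\
    (forall k x, (k < N)%nat -> A x -> exists z, A z /\ label k z /\ f z = x) /\
    (forall j k z w, j <> k -> A z -> A w -> label j z -> label k w ->
      delta < Cmod (z - w)).
Proof.
  intros Hf0 Hne Hgrow; destruct (derivative_function f Hf0) as [df Hf].
  pose proof PI_RGT_0 as HPI; pose proof PI_4 as HPI4; pose proof (pos_INR N) as HN0.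
  (* The targets differ from [F p] by less than 16 in real part and, since [PI <= 4], by at most
     [16 * INR N] in imaginary part. *)
  destruct (covering_theorem (17 + 16 * INR N)) as [L HL]; [lra|].
  (* The factor [exp L] makes [ln |f z1|] exceed [ln r] by at least [L]; the lower bound on the
     radius allows [small_value_on_circle]. *)
  destruct (Hgrow (exp L) (Cmod (f 0) + 1)) as [z1 [Hz1 Hbig]].
  set (r := Cmod z1) in *.
  pose proof (Cmod_ge_0 (f 0)) as Hf00.
  assert (Hr : 0 < r) by lra.
  destruct (small_value_on_circle f df r Hf Hne) as [z0 [Hz0 Hsmall]]; [lra|].
  set (a := ln r).
  assert (Hea : exp a = r) by (apply exp_ln, Hr).
  destruct (polar_form z0 0) as [t0 [Ht0 E0]]; [apply Cmod_gt_0; lra|].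
  destruct (polar_form z1 0) as [t1 [Ht1 E1]]; [apply Cmod_gt_0; exact Hr|].
  rewrite Hz0 in E0; fold r in E1; fold a in E0, E1.
  destruct (logarithm_on_disk f (exp (a + 19))) as [g Hg];
    [apply exp_pos|intros z _; apply Hf0|intros z _; apply Hne|].
  assert (Hmod : forall s w, Cmod (w - (a, t0)) < s -> Cmod (Cexp w) < exp (a + s)).
  { intros s w Hw; rewrite Cmod_Cexp; apply exp_increasing.
    pose proof (Rle_lt_trans _ _ _ (Rabs_fst_Cmod (w - (a, t0))) Hw) as K.
    apply Rabs_def2 in K; simpl in K; lra. }
  assert (Hexp_lt : forall s, s < 19 -> exp (a + s) < exp (a + 19)).
  { intros s Hs; apply exp_increasing; lra. }
  set (F := fun w => g (Cexp w)).
  assert (Hgd : forall z, Cmod z < exp (a + 19) -> C_diff g z (df z / f z)).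
  { intros z Hz; apply Hg; [exact Hz|apply Hf]. }
  assert (Hmodg : forall z, Cmod z < exp (a + 19) -> exp (fst (g z)) = Cmod (f z)).
  { intros z Hz; destruct (Hg z Hz) as [E _]; rewrite <- E, Cmod_Cexp; reflexivity. }
  destruct (HL F (fun w => df (Cexp w) / f (Cexp w) * Cexp w)%C (a, t0) (a, t1) a)
    as [p (Hp & Hpa & Hcov)].
  { intros w Hw; apply (C_diff_comp g Cexp); [apply C_diff_Cexp|].
    apply Hgd, Rlt_trans with (exp (a + 18)); [apply Hmod, Hw|apply Hexp_lt; lra]. }
  { eapply Rle_trans; [apply Cmod_le_abs|simpl].
    rewrite Rplus_opp_r, Rabs_R0, Rplus_0_l; apply Rabs_le; lra. }
  { apply exp_le_inv; unfold F; rewrite E0, Hmodg, Hea; [exact Hsmall|].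
    rewrite Hz0, <- Hea; apply exp_increasing; lra. }
  { apply exp_le_inv; unfold F; rewrite E1, Hmodg, exp_plus, Hea.
    - rewrite Rmult_comm; apply Rlt_le, Hbig.
    - fold r; rewrite <- Hea; apply exp_increasing; lra. }
  set (y := snd (F p)) in *.
  (* Windows of length [2 * PI] spaced by [4 * PI] leave gaps of [2 * PI], the tolerance used for
     the uniform continuity of [g]. *)
  set (lo := fun k : nat => y + 4 * PI * INR k).
  assert (Hlo : forall j k : nat, (j < k)%nat -> lo j + 4 * PI <= lo k).
  { intros j k Hjk; unfold lo; apply le_INR in Hjk; rewrite S_INR in Hjk; nra. }
  destruct (closed_disk_uniformly_continuous g 0 (exp (a + 16)) (2 * PI)) as [d [Hd Hu]];
    [apply Rlt_le, exp_pos|lra| |].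
  { intros z Hz; replace (z - 0)%C with z in Hz by ring.
    eapply C_diff_cont, Hgd, Rle_lt_trans; [exact Hz|apply Hexp_lt; lra]. }
  set (A := fun x => exists w, Cmod (w - (a, t0)) < 16 /\ Cexp w = x).
  assert (HA : forall x, A x -> Cmod x < exp (a + 16)).
  { intros x [w [Hw <-]]; apply Hmod, Hw. }
  exists A, (fun k z => lo k <= snd (g z) < lo k + 2 * PI), (exp (a + 16)), (d / 2).
  split; [apply Rlt_le, exp_pos|]; split; [lra|]; split; [|split; [|split]].
  - exists (Cexp (a, t0)), (a, t0); split; [|reflexivity].
    replace ((a, t0) - (a, t0))%C with (RtoC 0) by ring; rewrite Cmod_0; lra.
  - intros x Hx; apply Rlt_le, HA, Hx.
  - intros k x Hk [w' [Hw' Ex]].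
    destruct (polar_form x (lo k)) as [t [Ht Et]]; [rewrite <- Ex; apply Cexp_neq_0|].
    replace (ln (Cmod x)) with (fst w') in Et by (rewrite <- Ex, Cmod_Cexp, ln_exp; reflexivity).
    (* This point is a logarithm of [x] with imaginary part in the [k]-th window. Its preimage [w]
       lies in the disk that defines [A], so [Cexp w] is again in [A]. *)
    destruct (Hcov (fst w', t)) as [w [Hw Ew]].
    { eapply Rle_lt_trans; [apply Cmod_le_abs|].
      change (Rabs (fst w' - fst (F p)) + Rabs (t - y) < 17 + 16 * INR N).
      rewrite Hpa.
      pose proof (Rle_lt_trans _ _ _ (Rabs_fst_Cmod (w' - (a, t0))) Hw') as K.
      change (Rabs (fst w' - a) < 16) in K.
      assert (K2 : Rabs (t - y) <= 16 * INR N).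
      { apply le_INR in Hk; rewrite S_INR in Hk; pose proof (pos_INR k).
        unfold lo in Ht; apply Rabs_le; nra. }
      lra. }
    exists (Cexp w); split; [exists w; split; [exact Hw|reflexivity]|].
    unfold F in Ew; rewrite Ew; split; [exact Ht|].
    destruct (Hg (Cexp w)) as [E _].
    { apply Rlt_trans with (exp (a + 16)); [apply Hmod, Hw|apply Hexp_lt; lra]. }
    rewrite <- E, Ew; exact Et.
  - intros j k z w Hjk Hz Hw Hlz Hlw.
    destruct (Rle_dec (Cmod (z - w)) (d / 2)) as [Hle|]; [exfalso|lra].
    assert (K : Cmod (g z - g w) < 2 * PI).
    { apply Hu; [|lra]; replace (w - 0)%C with w by ring; apply Rlt_le, HA, Hw. }
    pose proof (Rle_lt_trans _ _ _ (Rabs_snd_Cmod (g z - g w)) K) as K2.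
    change (Rabs (snd (g z) - snd (g w)) < 2 * PI) in K2; apply Rabs_def2 in K2.
    destruct (Nat.lt_gt_cases j k) as [Hcases _]; destruct (Hcases Hjk) as [H|H];
      specialize (Hlo _ _ H); lra.
Qed.

(** * Entropy of horseshoes *)

Lemma Rbar_lub_upper (E : Rbar -> Prop) (x : Rbar) : E x -> Rbar_le x (Rbar_lub E).
Proof.
  unfold Rbar_lub; exact (proj1 (proj2_sig (Rbar_ex_lub E)) x).
Qed.

Lemma Inf_seq_lower (u : nat -> Rbar) (x : Rbar) :
  (forall n, Rbar_le x (u n)) -> Rbar_le x (Inf_seq u).
Proof.
  intros H; rewrite Inf_eq_glb; unfold Rbar_glb.
  apply (proj2 (proj2_sig (Rbar_ex_glb _))).
  intros y [n ->]; apply H.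
Qed.

Lemma Rbar_log_power (N n : nat) (s : Rbar) : (0 < N)%nat -> (0 < n)%nat ->
  Rbar_le (INR (N ^ n)) s ->
  Rbar_le (ln (INR N)) (Rbar_mult (/ INR n) (Rbar_log s)).
Proof.
  intros HN Hn Hs.
  assert (HNR : 0 < INR N) by (apply lt_0_INR, HN).
  assert (HnR : 0 < INR n) by (apply lt_0_INR, Hn).
  assert (Hi : 0 < / INR n) by (apply Rinv_0_lt_compat, HnR).
  assert (Hp : 0 < INR N ^ n) by (apply pow_lt, HNR).
  rewrite pow_INR in Hs.
  destruct s as [s| |]; simpl in Hs.
  - simpl; destruct (Rlt_dec 0 s) as [_|K]; [|lra]; simpl.
    apply Rmult_le_reg_l with (INR n); [exact HnR|].
    rewrite <- Rmult_assoc, Rinv_r, Rmult_1_l by lra.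
    rewrite <- ln_pow by exact HNR; apply ln_le; assumption.
  - simpl; destruct (Rle_dec 0 (/ INR n)) as [H|K]; [|lra].
    destruct (Rle_lt_or_eq_dec _ _ H); [exact I|lra].
  - contradiction.
Qed.

(** Choosing preimages backwards from [x0] realises every itinerary of [n] labels by an orbit in
    [A], and two itineraries separate where they first differ; this gives [N ^ n] separated points.
    Compactness is asked of [X], which contains these orbits. *)
Lemma horseshoe_entropy (M : Metric_Space) (f : Base M -> Base M)
    (X A : Base M -> Prop) (label : nat -> Base M -> Prop) (N : nat) (delta : R) :
  compact_subset M X -> (forall x, A x -> X x) -> 0 < delta -> (0 < N)%nat ->
  (exists x, A x) ->
  (forall k x, (k < N)%nat -> A x -> exists z, A z /\ label k z /\ f z = x) ->
  (forall j k z w, j <> k -> A z -> A w -> label j z -> label k w ->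
    delta < dist M z w) ->
  Rbar_le (ln (INR N)) (topological_entropy M f).
Proof.
  intros HX HAX Hdelta HN [x0 Hx0] Hcov Hsep.
  assert (Hpick : exists pick : nat -> Base M -> Base M, forall k x, (k < N)%nat ->
    A x -> A (pick k x) /\ label k (pick k x) /\ f (pick k x) = x).
  { assert (H : forall k x, exists z, (k < N)%nat -> A x -> A z /\ label k z /\ f z = x).
    { intros k x; destruct (classic ((k < N)%nat /\ A x)) as [[Hk Hx]|Hno].
      - destruct (Hcov k x Hk Hx) as [z Hz]; exists z; intros _ _; exact Hz.
      - exists x; intros Hk Hx; exfalso; apply Hno; split; assumption. }
    exists (fun k x => proj1_sig (constructive_indefinite_description _ (H k x))).
    intros k x; apply (proj2_sig (constructive_indefinite_description _ (H k x))). }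
  destruct Hpick as [pick Hpick].
  (* Itineraries of length [n] are the base-[N] digits of numbers below [N ^ n]. *)
  set (pt := fix pt (n m : nat) : Base M :=
    match n with O => x0 | S n' => pick (m mod N)%nat (pt n' (m / N)%nat) end).
  assert (Hmod : forall m, (m mod N < N)%nat) by (intros m; apply Nat.mod_upper_bound; lia).
  assert (HptA : forall n m, A (pt n m)).
  { induction n as [|n IH]; intros m; [exact Hx0|].
    apply (Hpick _ _ (Hmod m) (IH _)). }
  assert (Hptf : forall n m, f (pt (S n) m) = pt n (m / N)%nat).
  { intros n m; apply (Hpick _ _ (Hmod m) (HptA _ _)). }
  assert (Horbit : forall n k m, (k <= n)%nat -> A (Nat.iter k f (pt n m))).
  { induction n as [|n IH]; intros k m Hk.
    - replace k with O by lia; apply HptA.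
    - destruct k as [|k]; [apply HptA|].
      rewrite Nat.iter_succ_r, Hptf; apply IH; lia. }
  assert (Hdist : forall n m m', (m < N ^ n)%nat -> (m' < N ^ n)%nat -> m <> m' ->
    exists k, (k < n)%nat /\
      dist M (Nat.iter k f (pt n m)) (Nat.iter k f (pt n m')) > delta).
  { induction n as [|n IH]; intros m m' Hm Hm' Hne; [simpl in Hm, Hm'; lia|].
    (* The lowest digit labels the point itself and the quotient codes its image, so equal lowest
       digits defer the comparison by one iterate. *)
    destruct (Nat.eq_dec (m mod N) (m' mod N)) as [E|E].
    - destruct (IH (m / N)%nat (m' / N)%nat) as [k [Hk Hd]].
      + apply Nat.Div0.div_lt_upper_bound; simpl in Hm; lia.
      + apply Nat.Div0.div_lt_upper_bound; simpl in Hm'; lia.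
      + intros E2; apply Hne.
        rewrite (Nat.div_mod_eq m N), (Nat.div_mod_eq m' N), E, E2; reflexivity.
      + exists (S k); split; [lia|]; rewrite !Nat.iter_succ_r, !Hptf; exact Hd.
    - exists O; split; [lia|]; apply (Hsep (m mod N) (m' mod N))%nat; try apply HptA;
        [exact E|apply (Hpick _ _ (Hmod m) (HptA _ _))|
         apply (Hpick _ _ (Hmod m') (HptA _ _))]. }
  assert (Hcard : forall n, Rbar_le (INR (N ^ n)) (max_separated M f X n delta)).
  { intros n; apply (proj1 (Lub_Rbar_correct _)).
    assert (Hin : forall z, In z (map (pt n) (seq 0 (N ^ n))) ->
      exists m, (m < N ^ n)%nat /\ pt n m = z).
    { intros z Hz; apply in_map_iff in Hz; destruct Hz as [m [E Hm]].
      apply in_seq in Hm; exists m; split; [lia|exact E]. }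
    exists (map (pt n) (seq 0 (N ^ n))); split; [|split; [split; [|split]|]].
    - apply Injective_map_NoDup_in; [|apply seq_NoDup].
      intros m m' Hm Hm' E; apply in_seq in Hm; apply in_seq in Hm'.
      apply NNPP; intros Hne.
      destruct (Hdist n m m' ltac:(lia) ltac:(lia) Hne) as [k [_ Hd]].
      rewrite E, (proj2 (dist_refl M _ _) eq_refl) in Hd; lra.
    - intros z Hz; destruct (Hin z Hz) as [m [_ <-]]; apply HAX, HptA.
    - intros z Hz k Hk; destruct (Hin z Hz) as [m [_ <-]]; apply HAX, Horbit; lia.
    - intros z w Hz Hw Hne.
      destruct (Hin z Hz) as [m [Hm <-]]; destruct (Hin w Hw) as [m' [Hm' <-]].
      apply Hdist; [exact Hm|exact Hm'|congruence].
    - rewrite length_map, length_seq; reflexivity. }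
  apply Rbar_le_trans with (entropy_on M X f);
    [|apply Rbar_lub_upper; exists X; split; [exact HX|reflexivity]].
  eapply Rbar_le_trans;
    [|apply Rbar_lub_upper; exists delta; split; [exact Hdelta|reflexivity]].
  apply Inf_seq_lower; intros m.
  (* Index 1 keeps [1 + m] positive in every tail, as [Rbar_log_power] requires; index 0 would fail
     for [m = 0]. *)
  apply (Sup_seq_minor_le _ _ 1).
  apply Rbar_log_power; [exact HN|lia|apply Hcard].
Qed.

Theorem theorem1p2 (f : C -> C) (Hf : transcendental_entire f)
  (Homit : exists beta : C, omitted_value f beta) :
  topological_entropy C_Metric_Space f = p_infty.
Proof.
  destruct Hf as [Hent Hpoly]; destruct Homit as [beta Hbeta].
  assert (Hd : forall z, exists l, C_diff f z l).
  { intros z; destruct (Hent z) as [l Hl]; exists l; apply is_derive_C_diff, Hl. }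
  (* Conjugating by the translation by [beta] moves the omitted value to 0; a horseshoe of [h] then
     carries back to [f] with the same distances. *)
  set (h := fun z => (f (beta + 1 * z) - beta)%C).
  assert (Hhd : forall z, exists l, C_diff h z l).
  { intros z; destruct (Hd (beta + 1 * z)%C) as [l Hl]; eexists.
    apply C_diff_minus; [|apply C_diff_const].
    apply (C_diff_comp f (fun w => beta + 1 * w)%C); [apply C_diff_affine|exact Hl]. }
  assert (Hh0 : forall z, h z <> RtoC 0).
  { intros z K; apply (Hbeta (beta + 1 * z)%C); unfold h in K.
    replace (f (beta + 1 * z)%C) with (f (beta + 1 * z) - beta + beta)%C by ring.
    rewrite K; ring. }
  assert (Hgrow : forall K r, exists z, r <= Cmod z /\ K * Cmod z < Cmod (h z)).
  (* Otherwise [h] grows at most linearly, is affine by [linear_growth_affine], and [f] is a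
     polynomial. *)
  { intros K r; apply NNPP; intros Hno; apply Hpoly.
    destruct (derivative_function h Hhd) as [dh Hdh].
    destruct (linear_growth_affine h dh K r Hdh) as [c0 [c1 Hc]].
    { intros z Hz; destruct (Rle_dec (Cmod (h z)) (K * Cmod z)) as [H|H]; [exact H|].
      exfalso; apply Hno; exists z; split; lra. }
    exists 1%nat, (fun k => match k with O => beta + c0 - c1 * beta | _ => c1 end)%C.
    intros z; rewrite sum_Sn, sum_O; simpl.
    specialize (Hc (z - beta)%C); unfold h in Hc.
    replace (beta + 1 * (z - beta))%C with z in Hc by ring.
    replace (f z) with (f z - beta + beta)%C by ring; rewrite Hc.
    change ((c0 + c1 * (z - beta) + beta
      = (beta + c0 - c1 * beta) * 1 + c1 * (z * 1))%C); ring. }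
  assert (Hall : forall N, (0 < N)%nat ->
    Rbar_le (ln (INR N)) (topological_entropy C_Metric_Space f)).
  { intros N HN.
    destruct (horseshoe h N Hhd Hh0 Hgrow)
      as (A & label & B & delta & HB & Hdelta & [x0 Hx0] & HAB & Hcov & Hsep).
    apply (horseshoe_entropy C_Metric_Space f (fun z => Cmod (z - beta)%C <= B)
      (fun z => A (z - beta)%C) (fun k z => label k (z - beta)%C) N delta);
      [apply compact_closed_disk, HB|intros x Hx; apply HAB, Hx|exact Hdelta|exact HN| | |].
    - exists (beta + x0)%C; replace (beta + x0 - beta)%C with x0 by ring; exact Hx0.
    - intros k x Hk Hx; destruct (Hcov k _ Hk Hx) as (z & Hz & Hl & E).
      exists (beta + 1 * z)%C; replace (beta + 1 * z - beta)%C with z by ring.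
      split; [exact Hz|split; [exact Hl|]].
      replace (f (beta + 1 * z)%C) with (h z + beta)%C by (unfold h; ring).
      rewrite E; change ((x - beta + beta)%C = (x : C)); ring.
    - intros j k z w Hjk Hz Hw Hlz Hlw.
      change (delta < Cmod (z - w)%C).
      replace (z - w)%C with ((z - beta) - (w - beta))%C by ring.
      apply (Hsep j k); assumption. }
  destruct (topological_entropy C_Metric_Space f) as [x| |]; [exfalso|reflexivity|].
  (* A finite value [x] would bound [ln (INR N)] for every [N]. *)
  - destruct (INR_unbounded (exp x)) as [N HN].
    pose proof (exp_pos x) as Hx.
    assert (HN0 : (0 < N)%nat) by (apply INR_lt; simpl; lra).
    specialize (Hall N HN0); simpl in Hall.
    apply (Rlt_not_le _ _ HN).
    rewrite <- (exp_ln (INR N)) by lra.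
    destruct Hall as [H| ->]; [apply Rlt_le, exp_increasing, H|lra].
  (* The value [m_infty] is excluded by a single branch, since [ln 1] is finite. *)
  - exfalso; exact (Hall 1%nat Nat.lt_0_1).
Qed.
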